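(* Let $N\ge 2$ be an integer, let $(X,d,\mathcal H^N)$ be a non-collapsing $\mathsf{RCD}(0,N)$ space and let $\nu\in\mathcal P_2(X)$ be a probability measure on $X$ satisfying $\mathsf b(\nu)\cap\mathcal R_N\neq\emptyset$. Then $$-\mathsf{Ent}_{\mathcal H^N}(\nu)\le \frac N2\log\left(\frac{2\pi e}{N}\mathsf{Var}(\nu)\right).$$
   Context: A metric measure space $(X,d,\mathfrak m)$ consists of a complete separable metric space $(X,d)$ and a locally finite Borel measure $\mathfrak m$ on $X$ with $\operatorname{supp}\mathfrak m=X$ and $\int_X e^{-Cd^2(x_0,x)}\,\mathfrak m(dx)<\infty$ for some $C>0$, $x_0\in X$. $\mathcal P_2(X)$ is the set of Borel probability measures on $X$ with finite second moment, equipped with the $L^2$-Wasserstein distance $W_2$. The relative entropy is $\mathsf{Ent}_{\mathfrak m}(\mu)=\int_{\{\rho>0\}}\rho\log\rho\,d\mathfrak m$ if $\mu=\rho\mathfrak m\ll\mathfrak m$, and $+\infty$ otherwise (it never takes the value $-\infty$ on $\mathcal P_2(X)$), and $U_N(\mu)=\exp(-\frac1N\mathsf{Ent}_{\mathfrak m}(\mu))$. The Cheeger energy of $f\in L^2(\mathfrak m)$ is $\mathsf{Ch}(f)=\frac12\inf\{\liminf_n\int_X(\mathsf{Lip} f_n)^2d\mathfrak m: f_n\text{ locally Lipschitz},\ f_n\to f\text{ in }L^2\}$, where $\mathsf{Lip} f(x)=\limsup_{y\to x}|f(x)-f(y)|/d(x,y)$ ($0$ at isolated points). The space is infinitesimally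 Hilbertian if $\mathsf{Ch}(f+g)+\mathsf{Ch}(f-g)=2\mathsf{Ch}(f)+2\mathsf{Ch}(g)$ for all $f,g$ with finite Cheeger energy. For $N\in(1,\infty)$, $(X,d,\mathfrak m)$ is an $\mathsf{RCD}(0,N)$ space if it is infinitesimally Hilbertian and any $\mu_0,\mu_1\in\mathcal P_2(X)$ with finite entropy are joined by a constant speed $W_2$-geodesic $(\mu_t)_{t\in[0,1]}$ with $U_N(\mu_t)\ge(1-t)U_N(\mu_0)+tU_N(\mu_1)$ for all $t\in[0,1]$. A non-collapsing $\mathsf{RCD}(0,N)$ space $(X,d,\mathcal H^N)$ is an $\mathsf{RCD}(0,N)$ space, $N$ an integer, whose reference measure is the $N$-dimensional Hausdorff measure $\mathcal H^N$. Pointed measured Gromov (pmG) convergence $(X_i,d_i,\mathfrak m_i,x_i)\to(X_\infty,d_\infty,\mathfrak m_\infty,x_\infty)$ means: there are a complete separable metric space $Z$ and isometric embeddings of all the spaces into $Z$ such that the images of $x_i$ converge to the image of $x_\infty$ and the push-forward measures converge tested against bounded continuous functions with bounded support. The regular set $\mathcal R_N$ is the set of $x\in X$ such that the only pmG limit of $(X,r_i^{-1}d,\mathfrak m(B_{r_i}(x))^{-1}\mathfrak m,x)$ along sequences $r_i\downarrow0$ is $\mathbb R^N$ with Euclidean distance, Lebesgue measure normalized to give the unit ball mass $1$, and base point the origin. (For non-collapsing spaces, $x\in\mathcal R_N$ iff $\lim_{t\downarrow0}\mathcal H^N(B_t(x))/(\omega_Nt^N)=1$, where $\omega_N=\pi^{N/2}/\Gamma(1+N/2)$.)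 $\mathsf{Var}(\nu)=\min_{z\in X}\int_Xd^2(z,y)\,\nu(dy)$, and $\mathsf b(\nu)$ (set of barycenters) is the set of points $z\in X$ attaining this minimum. Conventions: $\log 0=-\infty$, and the left-hand side is $-\infty$ if $\mathsf{Ent}_{\mathcal H^N}(\nu)=+\infty$. *)

(* Defs.v *)
From HB Require Import structures.
From mathcomp Require Import all_boot all_order all_algebra.
From mathcomp Require Import all_classical all_reals all_analysis.
From mathcomp Require Import ring.

Set Implicit Arguments.
Unset Strict Implicit.
Unset Printing Implicit Defensive.

Import Order.TTheory GRing.Theory Num.Theory.
Import numFieldNormedType.Exports.

Local Open Scope classical_set_scope.
Local Open Scope ring_scope.

(* Measurable spaces of the library are inhabited, hence the chosen point. The
   point plays no other role. *)
#[short(type="pmetricType")]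
HB.structure Definition PointedMetric (R : numDomainType) :=
  {T of Metric R T & Pointed T}.

Notation borel X := (g_sigma_algebraType (@open X)).

Section metric.
Context {R : realType}.
Implicit Types X Y : pmetricType R.

Definition metric_complete X : Prop :=
  forall F : set_system X, ProperFilter F -> cauchy F -> cvg F.

Definition separable X : Prop := exists D : set X, countable D /\ dense D.

Definition isometric X Y (f : X -> Y) : Prop :=
  forall u v, mdist (f u) (f v) = mdist u v.

Definition locally_lipschitz X (f : X -> R) : Prop :=
  forall x : X, exists (U : set X) (L : R), nbhs x U /\
    forall y z, U y -> U z -> `|f y - f z| <= L * mdist y z.

(* At an isolated point the punctured neighbourhoods contain [set0], the limsup
   is [-oo], and the [maxe] gives the conventional value 0. *)
Definition Lip X (f : X -> R) (x : X) : \bar R :=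
  maxe 0%E (limf_esup (fun y => (`|f x - f y| / mdist x y)%:E) x^').

Definition diam X (E : set X) : \bar R :=
  maxe 0%E (ereal_sup [set (mdist u.1 u.2)%:E | u in E `*` E]).

End metric.

Section hausdorff.
Context {R : realType}.
Local Open Scope ereal_scope.

Definition Gamma (s : R) : R :=
  fine (\int[lebesgue_measure]_(t in `]0%R, +oo[%classic)
          (t `^ (s - 1) * expR (- t))%:E).

Definition omega (N : nat) : R :=
  (pi `^ (N%:R / 2) / Gamma (1 + N%:R / 2))%R.

(* The factor [omega N / 2 ^+ N] makes the N-dimensional Hausdorff measure of R^N
   equal to the Lebesgue measure. *)
Definition hausdorff_pre (X : pmetricType R) (N : nat) (delta : R)
    (A : set X) : \bar R :=
  ereal_inf [set \sum_(k <oo) ((omega N / 2 ^+ N)%:E * diam (E k) ^+ N)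
    | E in [set E : (set X)^nat | A `<=` \bigcup_k E k /\
                                 forall k, diam (E k) <= delta%:E]].

Definition hausdorff (X : pmetricType R) (N : nat) (A : set X) : \bar R :=
  ereal_sup [set hausdorff_pre N delta A | delta in [set delta | (0 < delta)%R]].

End hausdorff.

Section mms.
Context {R : realType} {X : pmetricType R}.
Implicit Types (m : {measure set (borel X) -> \bar R}).
Implicit Types (mu nu : probability (borel X) R).
Local Open Scope ereal_scope.

Definition msupport m : set X :=
  [set x | forall U : set X, open U -> U x -> 0 < m U].

Definition is_mms m : Prop :=
  [/\ metric_complete X, separable X,
      forall x : X, exists U : set X, [/\ open U, U x & m U < +oo],
      msupport m = setT &
      exists (C : R) (x0 : X), (0 < C)%R /\
        \int[m]_x (expR (- C * mdist x0 x ^+ 2))%:E < +oo].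

Definition P2 mu : Prop :=
  exists x0 : X, \int[mu]_x (mdist x0 x ^+ 2)%:E < +oo.

Definition coupling mu nu
    (p : probability (borel X * borel X)%type R) : Prop :=
  forall A : set (borel X), measurable A ->
    p (fst @^-1` A) = mu A /\ p (snd @^-1` A) = nu A.

Definition W2 mu nu : \bar R :=
  (ereal_inf [set \int[p]_z (@mdist R X z.1 z.2 ^+ 2)%:E
             | p in [set p | coupling mu nu p]]) `^ 2^-1.

(* Two measures are identified when they agree on the Borel sets; the values of
   the underlying functions on other sets are irrelevant. *)
Definition W2_geodesic (mu : R -> probability (borel X) R)
    (mu0 mu1 : probability (borel X) R) : Prop :=
  [/\ forall A : set (borel X), measurable A -> mu 0%R A = mu0 A,
      forall A : set (borel X), measurable A -> mu 1%R A = mu1 A,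
      forall t, (0 <= t <= 1)%R -> P2 (mu t) &
      forall s t, (0 <= s <= 1)%R -> (0 <= t <= 1)%R ->
        W2 (mu s) (mu t) = `|t - s|%:E * W2 mu0 mu1].

Definition is_density m mu (rho : X -> R) : Prop :=
  [/\ measurable_fun [set: borel X] (rho : borel X -> R),
      forall x, (0 <= rho x)%R &
      forall A : set (borel X), measurable A ->
        mu A = \int[m]_(x in A) (rho x)%:E].

(* Two densities agree m-almost everywhere, so that the infimum is over the
   empty set (value [+oo]) or over a singleton. *)
Definition Ent m mu : \bar R :=
  ereal_inf [set \int[m]_(x in [set x | (0 < rho x)%R]) (rho x * ln (rho x))%:E
            | rho in [set rho : X -> R | is_density m mu rho]].

Definition U_ (N : R) m mu : \bar R := expeR (- (N^-1%:E * Ent m mu)).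

Definition L2_cvg m (F : nat -> X -> R) (f : X -> R) : Prop :=
  (forall n, (F n : borel X -> R) \in Lfun m 2%:E) /\
  'N[m]_2%:E [EFin \o (F n \- f)%R] @[n --> \oo] --> 0.

Definition Ch m (f : X -> R) : \bar R :=
  (2^-1)%:E * ereal_inf
    [set limn_einf (fun n => \int[m]_x (Lip (F n) x ^+ 2))
    | F in [set F : nat -> X -> R |
             (forall n, locally_lipschitz (F n)) /\ L2_cvg m F f]].

Definition infinitesimally_hilbertian m : Prop :=
  forall f g : X -> R,
    (f : borel X -> R) \in Lfun m 2%:E -> (g : borel X -> R) \in Lfun m 2%:E ->
    Ch m f < +oo -> Ch m g < +oo ->
    Ch m (f \+ g)%R + Ch m (f \- g)%R = 2%:E * Ch m f + 2%:E * Ch m g.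

Definition RCD0 (N : R) m : Prop :=
  [/\ is_mms m, infinitesimally_hilbertian m &
    forall mu0 mu1, P2 mu0 -> P2 mu1 ->
      Ent m mu0 \is a fin_num -> Ent m mu1 \is a fin_num ->
      exists mu : R -> probability (borel X) R,
        W2_geodesic mu mu0 mu1 /\
        forall t, (0 <= t <= 1)%R ->
          (1 - t)%:E * U_ N m mu0 + t%:E * U_ N m mu1 <= U_ N m (mu t)].

Definition noncollapsed_RCD0 (N : nat) m : Prop :=
  RCD0 N%:R m /\
  forall A : set (borel X), measurable A -> m A = hausdorff N (A : set X).

Definition cost nu (z : X) : \bar R := \int[nu]_y (mdist z y ^+ 2)%:E.

Definition Var nu : \bar R := ereal_inf (range (cost nu)).

Definition barycenters nu : set X := [set z | cost nu z = Var nu].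

End mms.

(* [rescaled r X] is [X] with the distance [r^-1 * d]. *)
Definition rescaled {R : realType} (r : {posnum R}) (X : Type) : Type := X.

Section rescaled.
Context {R : realType} (r : {posnum R}) (X : pmetricType R).
Local Notation X' := (rescaled r X).

HB.instance Definition _ := Pointed.copy X' X.

Let d (x y : X') : R := r%:num^-1 * @mdist R X x y.

Let dxx x : d x x = 0.
Proof. by rewrite /d mdistxx mulr0. Qed.

Let d_pos x y : d x y = 0 -> x = y.
Proof.
move/eqP; rewrite mulf_eq0 invr_eq0 gt_eqF//= => /eqP.
exact: mdist_positivity.
Qed.

Let d_sym x y : d x y = d y x.
Proof. by rewrite /d metric_sym. Qed.

Let d_triangle y x z : d x z <= d x y + d y z.
Proof. by rewrite /d -mulrDr ler_pM2l// metric_triangle. Qed.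

HB.instance Definition _ := isMetric.Build R X' dxx d_pos d_sym d_triangle.

Lemma mdist_rescaledE (x y : X) :
  @mdist R (rescaled r X) x y = r%:num^-1 * mdist x y.
Proof. by []. Qed.

Lemma ball_rescaledE (x : X) (e : R) :
  @ball R (rescaled r X) x e = @ball R X x (r%:num * e).
Proof.
rewrite !ballEmdist; apply/seteqP; split => y /=.
  by rewrite mdist_rescaledE ltr_pdivrMl.
by rewrite mdist_rescaledE ltr_pdivrMl.
Qed.

Lemma open_rescaledE : @open (rescaled r X) = @open X.
Proof.
apply/funext => A; apply/propext; rewrite !openE; split => oA x Ax.
- have /nbhs_ballP[e /= e0 xeA] := oA x Ax.
  apply/nbhs_ballP; exists (r%:num * e) => /=; first by rewrite mulr_gt0.
  by move=> y; rewrite -ball_rescaledE; exact: xeA.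
- have /nbhs_ballP[e /= e0 xeA] := oA x Ax.
  apply/nbhs_ballP; exists (r%:num^-1 * e) => /=; first by rewrite mulr_gt0.
  by move=> y; rewrite ball_rescaledE mulVKf// => ?; exact: xeA.
Qed.

End rescaled.

Section rescaled_measure.
Context {R : realType} (r : {posnum R}) (X : pmetricType R).

Definition rescaled_space : pmetricType R :=
  [the pmetricType R of rescaled r X].

Definition to_rescaled : borel X -> borel rescaled_space := id.

Lemma measurable_to_rescaled : measurable_fun setT to_rescaled.
Proof.
apply: measurability => // _ [A oA <-].
rewrite setTI /to_rescaled preimage_id.
have E : @open rescaled_space = @open X := open_rescaledE r X.
by apply: sub_gen_smallest; rewrite -E.
Qed.

Definition rescaled_measure (m : {measure set (borel X) -> \bar R}) :
    {measure set (borel rescaled_space) -> \bar R} :=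
  measure_function_pushforward__canonical__measure_function_Measure
    m measurable_to_rescaled.

End rescaled_measure.

(* R^N with the Euclidean distance; the instance on ['rV[R]_N] is the sup
   distance. *)
Definition euclid (R : realType) (N : nat) : Type := 'rV[R]_N.

Section euclid.
Context {R : realType} {N : nat}.
Local Notation E := (euclid R N).

Definition euclid0 : E := (0 : 'rV[R]_N).

HB.instance Definition _ := Choice.copy E 'rV[R]_N.
HB.instance Definition _ := isPointed.Build E euclid0.

Let d (x y : E) : R := Num.sqrt (\sum_i (x 0 i - y 0 i) ^+ 2).

Let dxx x : d x x = 0.
Proof. by rewrite /d big1 ?sqrtr0// => i _; rewrite subrr expr0n. Qed.

Let d_pos x y : d x y = 0 -> x = y.
Proof.
move/eqP; rewrite sqrtr_eq0 => s0.
have {s0} : \sum_i (x 0 i - y 0 i) ^+ 2 == 0.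
  by rewrite eq_le s0/= sumr_ge0// => i _; exact: sqr_ge0.
rewrite psumr_eq0 => [/allP h|i _]; last exact: sqr_ge0.
apply/rowP => i; apply/eqP; rewrite -subr_eq0 -sqrf_eq0.
by have := h i; rewrite mem_index_enum; apply.
Qed.

Let d_sym x y : d x y = d y x.
Proof. by rewrite /d; congr Num.sqrt; apply: eq_bigr => i _; rewrite -sqrrN opprB. Qed.

Let cauchy_schwarz (a b : 'I_N -> R) :
  (\sum_i a i * b i) ^+ 2 <= (\sum_i a i ^+ 2) * (\sum_i b i ^+ 2).
Proof.
have : 0 <= \sum_i \sum_j (a i * b j - a j * b i) ^+ 2.
  by apply: sumr_ge0 => i _; apply: sumr_ge0 => j _; exact: sqr_ge0.
have -> : \sum_i \sum_j (a i * b j - a j * b i) ^+ 2 =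
    2 * ((\sum_i a i ^+ 2) * (\sum_i b i ^+ 2) - (\sum_i a i * b i) ^+ 2).
  have AB : (\sum_i a i ^+ 2) * (\sum_i b i ^+ 2) =
      \sum_i \sum_j a i ^+ 2 * b j ^+ 2.
    by rewrite mulr_suml; apply: eq_bigr => i _; rewrite mulr_sumr.
  have BA : (\sum_i a i ^+ 2) * (\sum_i b i ^+ 2) =
      \sum_i \sum_j a j ^+ 2 * b i ^+ 2.
    by rewrite AB exchange_big.
  have C : (\sum_i a i * b i) ^+ 2 = \sum_i \sum_j (a i * b i) * (a j * b j).
    by rewrite expr2 mulr_suml; apply: eq_bigr => i _; rewrite mulr_sumr.
  rewrite mulrBr mulr_natl mulr2n {1}AB BA C.
  rewrite mulr_sumr -big_split -sumrB; apply: eq_bigr => i _ /=.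
  rewrite mulr_sumr -big_split -sumrB; apply: eq_bigr => j _ /=.
  by ring.
by rewrite pmulr_rge0// subr_ge0.
Qed.

Let d_triangle y x z : d x z <= d x y + d y z.
Proof.
have ge0 (a : 'I_N -> R) : 0 <= \sum_i a i ^+ 2.
  by apply: sumr_ge0 => i _; exact: sqr_ge0.
rewrite -(@ler_pXn2r _ 2)// ?nnegrE ?addr_ge0 ?sqrtr_ge0//.
rewrite sqrrD !sqr_sqrtr//.
set a := fun i => x 0 i - y 0 i; set b := fun i => y 0 i - z 0 i.
have -> : \sum_i (x 0 i - z 0 i) ^+ 2 =
    \sum_i a i ^+ 2 + (\sum_i a i * b i) *+ 2 + \sum_i b i ^+ 2.
  rewrite -sumrMnl -!big_split; apply: eq_bigr => i _ /=.
  by rewrite /a /b; ring.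
rewrite lerD2r lerD2l lerMn2r/=.
apply: (le_trans (ler_norm _)); rewrite -sqrtr_sqr /d -sqrtrM//.
by rewrite ler_wsqrtr// cauchy_schwarz.
Qed.

HB.instance Definition _ := isMetric.Build R E dxx d_pos d_sym d_triangle.

Lemma mdist_euclidE (x y : E) :
  mdist x y = Num.sqrt (\sum_i (x 0 i - y 0 i) ^+ 2).
Proof. by []. Qed.

End euclid.
Arguments euclid0 {R N}.

Definition euclid_space (R : realType) (N : nat) : pmetricType R :=
  [the pmetricType R of euclid R N].

Section lebesgue.
Context {R : realType} {N : nat}.

Definition box (ab : 'rV[R]_N * 'rV[R]_N) : set (euclid R N) :=
  [set x | forall i, ab.1 0 i <= x 0 i <= ab.2 0 i].

(* Lebesgue outer measure; only its values on Borel sets are used. *)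
Definition lebesgueN (A : set (euclid R N)) : \bar R :=
  (ereal_inf [set \sum_(k <oo) (\prod_i ((ab k).2 0 i - (ab k).1 0 i))%:E
    | ab in [set ab : nat -> 'rV[R]_N * 'rV[R]_N |
              (forall k i, ((ab k).1 0 i <= (ab k).2 0 i)%R) /\
              A `<=` \bigcup_k box (ab k)]])%E.

End lebesgue.

Record pmms (R : realType) := PMMS {
  pmms_car :> pmetricType R ;
  pmms_meas : {measure set (borel pmms_car) -> \bar R} ;
  pmms_base : pmms_car }.

Section pmG.
Context {R : realType}.
Local Open Scope ereal_scope.

Definition bounded_support (Z : pmetricType R) (phi : Z -> R) : Prop :=
  exists (z0 : Z) (r : R), forall z, (r < mdist z0 z)%R -> phi z = 0%R.

Definition pmG_cvg (S : nat -> pmms R) (S' : pmms R) : Prop :=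
  exists (Z : pmetricType R) (f : forall i, S i -> Z) (g : S' -> Z),
  [/\ metric_complete Z /\ separable Z,
      (forall i, isometric (f i)) /\ isometric g,
      f i (pmms_base (S i)) @[i --> \oo] --> g (pmms_base S') &
      forall phi : Z -> R, continuous phi ->
        (exists M : R, forall z, (`|phi z| <= M)%R) -> bounded_support phi ->
        \int[pushforward (pmms_meas (S i))
               (f i : borel (S i) -> borel Z)]_z (phi z)%:E @[i --> \oo] -->
        \int[pushforward (pmms_meas S')
               (g : borel S' -> borel Z)]_z (phi z)%:E].

(* Isomorphism with R^N endowed with the multiple of the Lebesgue measure giving
   mass 1 to the unit ball, pointed at the origin. *)
Definition is_euclidean (N : nat) (S : pmms R) : Prop :=
  exists h : S -> euclid_space R N,
  [/\ set_bij setT setT h, isometric h, h (pmms_base S) = euclid0 &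
      forall A : set (borel (euclid_space R N)), measurable A ->
        pushforward (pmms_meas S)
          (h : borel S -> borel (euclid_space R N)) A =
        ((fine (lebesgueN (@ball R (euclid_space R N) euclid0 1%R)))^-1)%:E
        * lebesgueN (A : set (euclid R N))].

Lemma inv_mass_ge0 (X : pmetricType R) (m : {measure set (borel X) -> \bar R})
  (B : set X) : (0 <= (fine (m B))^-1)%R.
Proof. by rewrite invr_ge0 fine_ge0. Qed.

Definition blowup (X : pmetricType R) (m : {measure set (borel X) -> \bar R})
    (x : X) (r : {posnum R}) : pmms R :=
  @PMMS R (rescaled_space r X)
    (mscale (NngNum (inv_mass_ge0 m (ball x r%:num))) (rescaled_measure r m))
    x.

Definition tangent (X : pmetricType R) (m : {measure set (borel X) -> \bar R})
    (x : X) (S : pmms R) : Prop :=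
  is_mms (pmms_meas S) /\
  exists r : nat -> {posnum R},
    [/\ nonincreasing_seq (fun i => (r i)%:num),
        (r i)%:num @[i --> \oo] --> (0 : R)%R &
        pmG_cvg (fun i => blowup m x (r i)) S].

(* The set of pointed measured tangents at [x], up to isomorphism, is the
   singleton of the normalized R^N. *)
Definition regular_set (X : pmetricType R)
    (m : {measure set (borel X) -> \bar R}) (N : nat) : set X :=
  [set x | (exists S, tangent m x S) /\
           (forall S, tangent m x S -> is_euclidean N S)].

End pmG.

(* Main.v *)
Require Import Defs.
From mathcomp Require Import all_boot all_order all_algebra.
From mathcomp Require Import all_classical all_reals all_analysis.
From mathcomp Require Import measurable_realfun ring lra.

(** On R^N the inequality is the maximality of the Gaussian entropy at given
    variance: Jensen's inequality against the weight exp (- c d^2(y, .)) gives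
      - Ent mu <= ln (\int exp (- c d^2(y, .)) dm) + c \int d^2(y, .) dmu
    ([Ent_ge_gauss]), the Gaussian integral is (pi / c)^(N/2), and the choice
    c = N / (2 Var) produces the constant 2 pi e / N.

    On X the same entropy bound holds, but the Gaussian integral is only
    understood as c tends to infinity, where it sees only the small balls around
    y: if m(B_r(y)) <= a omega_N r^N for small r, integrating over the level
    sets of the weight bounds it by a (pi / c)^(N/2) up to an exponentially
    small remainder ([gauss_integral_le]).  The measure nu is brought into that
    regime by contracting it towards y.  Along the geodesic from the uniform
    measure on a tiny ball around y to nu, the measure at time t has second
    moment about y at most t^2 s, for any s larger than that of nu, while the
    concavity of U_N gives it U_N at least t U_N(nu)
    ([exists_contraction]).  Both quantities scale exactly as under a dilation
    of R^N, so that applying the Gaussian bound with c = N / (2 t^2 s) and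
    letting t tend to 0 gives
      exp (- Ent nu) <= a (2 pi e s / N)^(N/2)
    ([expRN_Ent_le_of_growth]).

    Points y with a arbitrarily close to 1 are dense because m is the Hausdorff
    measure ([exists_small_density]): if every point of a nonempty open set U of
    finite measure were the centre of arbitrarily small balls with
    m(B_r) >= a omega_N r^N, then Vitali's covering argument would cover U by
    such balls and give H^N(U) <= m(U) / a, which is absurd for a > 1.  The
    second moment of nu about y depends continuously on y, so y may finally be
    moved to the barycenter, where it is the variance. *)

Set Implicit Arguments.
Unset Strict Implicit.
Unset Printing Implicit Defensive.

Import Order.TTheory GRing.Theory Num.Theory.
Import numFieldNormedType.Exports.

Local Open Scope classical_set_scope.
Local Open Scope ring_scope.

(** * Balls and distance functions in a metric space *)

Section metric_basics.
Context {R : realType} {X : pmetricType R}.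
Implicit Types (x y z : X) (r : R).

(** It may be larger than the closure of the open ball. *)
Definition clball x r : set X := [set z | mdist x z <= r].

Lemma mdist_triangleC x y z : mdist x z <= mdist x y + mdist z y.
Proof. by rewrite [mdist z y]metric_sym; exact: metric_triangle. Qed.

Lemma open_mball x r : open (ball x r : set X).
Proof.
rewrite openE => z; rewrite ballEmdist/= => xz.
apply/nbhs_ballP; exists (r - mdist x z) => /=; first by rewrite subr_gt0.
move=> w; rewrite !ballEmdist/= ltrBrDl; apply: le_lt_trans.
exact: metric_triangle.
Qed.

Lemma closed_clball x r : closed (clball x r).
Proof.
rewrite -openC openE => z /=; rewrite /clball/= => /negP; rewrite -ltNge => xz.
apply/nbhs_ballP; exists (mdist x z - r) => /=; first by rewrite subr_gt0.
move=> w; rewrite ballEmdist/= => zw; apply/negP; rewrite -ltNge.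
by have := mdist_triangleC x w z; lra.
Qed.

Lemma open_measurableX (U : set X) : open U -> measurable (U : set (borel X)).
Proof. exact: sub_gen_smallest. Qed.

Lemma closed_measurableX (U : set X) : closed U -> measurable (U : set (borel
  X)).
Proof.
by move=> cU; rewrite -(setCK U); apply: measurableC; apply: open_measurableX;
  exact: closed_openC.
Qed.

Lemma measurable_clball x r : measurable (clball x r : set (borel X)).
Proof. by apply: closed_measurableX; exact: closed_clball. Qed.

Lemma measurable_mball x r : measurable (ball x r : set (borel X)).
Proof. by apply: open_measurableX; exact: open_mball. Qed.

Lemma measurable_mdist x :
  measurable_fun [set: borel X] ((fun z => mdist x z) : borel X -> R).
Proof.
apply: (measurability _ (RGenOInfty.measurableE R)) => // _ [_ [r ->] <-].
rewrite setTI (_ : _ @^-1` _ = ~` clball x r); first by apply: measurableC;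
  exact: measurable_clball.
apply/seteqP; split => z /=; rewrite in_itv/= andbT /clball/= ltNge.
  by move/negP.
by move/negP.
Qed.

Lemma diam_clball x r : (diam (clball x r) <= (2 * Num.max r 0)%:E)%E.
Proof.
rewrite /diam ge_max lee_fin mulr_ge0//= ?le_max ?lexx ?orbT//.
apply: ge_ereal_sup => _ [[u v] /= [xu xv] <-].
have rr : r <= Num.max r 0 by rewrite le_max lexx.
have := mdist_triangleC u x v; rewrite lee_fin ![mdist _ x]metric_sym.
by move: xu xv rr; rewrite /clball /=; lra.
Qed.

End metric_basics.

(** * Vitali's covering argument *)

Section vitali.
Context {R : realType} {X : pmetricType R}.
Variables (F : set (X * R)) (eta : R).
Hypothesis F_le : forall p, F p -> 0 < p.2 <= eta.

Let B (p : X * R) : set X := clball p.1 p.2.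

Lemma clball_lt0 (x : X) (r : R) : r < 0 -> clball x r = set0.
Proof.
move=> r0; apply/seteqP; split => // z /=; rewrite /clball/= => /le_lt_trans.
by move=> /(_ _ r0); rewrite ltNge mdist_ge0.
Qed.

Let cand (K : set X) p := F p /\ B p `&` K = set0.

Let best (K : set X) p :=
  cand K p /\ forall p', cand K p' -> p'.2 <= 2 * p.2.

Let best_ex K : cand K !=set0 -> best K !=set0.
Proof.
move=> [p cp]; pose A : set R := [set q.2 | q in cand K].
have supA : has_sup A.
  split; first by exists p.2; exists p.
  by exists eta => _ [q [Fq _] <-]; have /andP[] := F_le Fq.
have sup_gt0 : 0 < sup A.
  have /andP[p0 _] := F_le cp.1.
  by apply: (lt_le_trans p0); apply: sup_upper_bound => //; exists p.
have := @sup_adherent _ A (sup A / 2) (divr_gt0 sup_gt0 (ltr0Sn _ 1)) supA.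
move=> [_ [q cq <-] hq]; exists q; split => // q' cq'.
have : q'.2 <= sup A by apply: sup_upper_bound => //; exists q'.
lra.
Qed.

(* The default has negative radius: its ball is empty and stands for the absence
   of candidates. *)
Let pick (K : set X) : X * R := xget (point, -1) (best K).

Let Fixpoint Ks n : set X :=
  if n is k.+1 then Ks k `|` B (pick (Ks k)) else set0.

Let P n := pick (Ks n).

Let P_spec n : best (Ks n) (P n) \/ ((P n).2 < 0 /\ cand (Ks n) = set0).
Proof.
rewrite /P /pick; have [e|ne] := pselect (best (Ks n) !=set0).
  by left; exact: xgetPex.
right; split.
  rewrite xgetPN ?ltrN10// => p bp; by apply: ne; exists p.
by apply/seteqP; split => // q cq; case: ne; apply: best_ex; exists q.
Qed.

Let KsE n : Ks n = \bigcup_(k in `I_n) B (P k).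
Proof.
elim: n => [|n ih]; first by rewrite II0 bigcup_set0.
by rewrite IIS bigcup_setU bigcup_set1 /= -ih.
Qed.

(** Balls are chosen greedily: each is disjoint from the previous ones and has
    at least half of the radius that is still possible.  If the radii tend to
    0, a ball B(x, r) of F that avoids the first n choices must meet a later
    one, and the first one that it meets has radius at least r / 2, hence
    contains x after tripling.  Keeping the first n balls as they are and
    tripling only the others is what makes the covering asymptotically
    lossless. *)
Lemma vitali_sequence : exists P : nat -> X * R,
  [/\ forall n, F (P n) \/ (P n).2 < 0,
      trivIset setT (fun n => clball (P n).1 (P n).2) &
      (forall e, 0 < e -> exists n, forall k, (n <= k)%N -> (P k).2 < e) ->
      forall n p, F p ->
        (forall k, (k < n)%N ->
          clball p.1 p.2 `&` clball (P k).1 (P k).2 = set0) ->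
        exists2 k, (n <= k)%N & clball (P k).1 (3 * (P k).2) p.1].
Proof.
exists P; split.
- by move=> n; case: (P_spec n) => [[[]]|[]]; [left|right].
- apply: ltn_trivIset => n2 n1 n12; rewrite setIC.
  case: (P_spec n2) => [[[_ h] _]|[r0 _]]; last by rewrite (clball_lt0 _ r0)
    set0I.
  apply/seteqP; split => // z [z2 z1]; rewrite -h; split => //.
  by rewrite KsE; exists n1.
- move=> Pe n p Fp disj; have /andP[p0 _] := F_le Fp.
  have [n0 hn0] := Pe (p.2 / 2) (divr_gt0 p0 (ltr0Sn _ 1)).
  have candn : cand (Ks n) p.
    split => //; apply/seteqP; split => // z [zp]; rewrite KsE => -[k /= kn zk].
    by have : (set0 : set X) z by rewrite -(disj k kn).
  (* [j] is the first step that makes [p] unavailable. *)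
  have /ex_minnP[j] : exists j, (n <= j)%N && ~~ `[< cand (Ks j.+1) p >].
    exists (maxn n n0); rewrite leq_maxl/=; apply/negP => /asboolP c.
    have c' : cand (Ks (maxn n n0)) p.
      by move: c => [Fp' /=]; rewrite setIUr setU_eq0 => -[].
    have := hn0 _ (leq_maxr n n0); case: (P_spec (maxn n n0)) => [[_ /(_ _
      c')]|[_]].
      lra.
    by move=> e; rewrite e in c'.
  move=> /andP[nj /asboolPn ncj] jmin; exists j => //.
  have cj : cand (Ks j) p.
    move: nj; rewrite leq_eqVlt => /predU1P[<-//|nj].
    case: j nj ncj jmin => // j nj ncj jmin; apply: contrapT => nc.
    have /jmin : (n <= j)%N && ~~ `[< cand (Ks j.+1) p >].
      by rewrite -ltnS nj; apply/asboolPn.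
    by rewrite ltnn.
  have [z [z1 z2]] : (B p `&` B (P j)) !=set0.
    apply/set0P/negP => /eqP e; apply: ncj; split; first by [].
    by rewrite /= setIUr cj.2 set0U.
  case: (P_spec j) => [[_ /(_ _ cj)]|[_ e]]; last by rewrite e in cj.
  move: z1 z2; rewrite /B /clball/= => z1 z2.
  by have := mdist_triangleC (P j).1 z p.1; lra.
Qed.

End vitali.

(** * The Gamma integral and the volume of the unit ball *)

Section gamma_integral.
Context {R : realType}.
Local Notation lam := (@lebesgue_measure R).

Lemma integral_expRN_itvy (a : R) :
  (\int[lam]_(u in `[a, +oo[%classic) (expR (- u))%:E = (expR (- a))%:E)%E.
Proof.
have cexp : continuous (fun u : R => expR (- u)).
  by move=> x; apply: continuous_comp; [exact: continuousN|exact: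
    continuous_expR].
rewrite (@ge0_continuous_FTC2y _ _ (fun u => - expR (- u)) a 0).
- by rewrite sub0e -EFinN opprK.
- by move=> x _; exact: expR_ge0.
- by apply: continuous_subspaceT => x; exact: cexp.
- by rewrite -oppr0; apply: cvgN; exact: cvgr_expR.
- by move=> x _; exact: ex_derive.
- by apply: cvgN; apply: cvg_at_right_filter; exact: cexp.
- by move=> x _; rewrite derive1E derive_val mulrN1 opprK.
Qed.

Let measurable_gamma (s : R) (D : set R) :
  measurable_fun D (fun t => (t `^ s * expR (- t))%:E).
Proof.
apply/measurable_EFinP; apply: measurable_funTS; apply: measurable_funM.
  exact: measurable_powR.
by apply: measurableT_comp => //; exact: measurable_oppr.
Qed.

(** [Gamma] is the [fine] of an integral, which is finite because
    ln t <= t / (2 a) + ln (2 a) makes t^a O(exp (t / 2)). *)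
Lemma Gamma_half_integral (N : nat) : (0 < N)%N ->
  ((Gamma (1 + N%:R / 2) : R)%:E =
   \int[lam]_(t in `]0%R, +oo[%classic) (t `^ (N%:R / 2) * expR (- t))%:E)%E.
Proof.
move=> N0; rewrite /Gamma; under eq_integral do rewrite addrAC subrr add0r.
rewrite fineK// ge0_fin_numE; last first.
  by apply: integral_ge0 => t _; rewrite lee_fin mulr_ge0 ?powR_ge0 ?expR_ge0.
set a : R := N%:R / 2.
have a0 : 0 < a by rewrite divr_gt0// ltr0n.
pose C := expR (a * ln (2 * a)).
have h2 : (0:R) < 2^-1 by [].
apply: (@le_lt_trans _ _
  (\int[lam]_t ((2 * C)%:E * (exponential_pdf (2^-1) t)%:E))%E).
  rewrite integral_mkcond; apply: ge0_le_integral => //.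
  - by move=> t _; apply: erestrict_ge0 => x _;
      rewrite lee_fin mulr_ge0 ?powR_ge0 ?expR_ge0.
  - apply/(measurable_restrictT _ _).1 => //; exact: (measurable_gamma a).
  - apply: emeasurable_funM => //; apply/measurable_EFinP.
    exact: measurable_exponential_pdf.
  - move=> t _; rewrite patchE; case: ifPn => [|_]; last first.
      by rewrite -EFinM lee_fin mulr_ge0 ?mulr_ge0 ?expR_ge0//
        exponential_pdf_ge0.
    rewrite inE/= in_itv/= andbT => t0.
    rewrite (_ : (_ * _)%E = (C * expR (- (t / 2)))%:E); last first.
      rewrite exponential_pdfE ?ltW// -EFinM mulrACA divff// mul1r.
      by rewrite mulNr [2^-1 * t]mulrC.
    rewrite lee_fin /powR gt_eqF// /C -!expRD ler_expR.
    have a2 : 0 < 2 * a by rewrite mulr_gt0.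
    have : ln (t / (2 * a)) <= t / (2 * a) by rewrite ltW// ln_sublinear//
      divr_gt0.
    rewrite ln_div// lerBlDr => /(ler_wpM2l (ltW a0)).
    rewrite mulrDr [a * (t / _)](_ : _ = t / 2); first lra.
    by rewrite invfM mulrCA [a * _]mulrCA mulfV ?gt_eqF// mulr1.
rewrite ge0_integralZl//.
- by rewrite integral_exponential_pdf// mule1 ltry.
- by apply/measurable_EFinP; exact: measurable_exponential_pdf.
- by move=> t _; rewrite lee_fin exponential_pdf_ge0// ltW.
- by rewrite lee_fin mulr_ge0// expR_ge0.
Qed.

Lemma Gamma_half_gt0 (N : nat) : (0 < N)%N -> 0 < Gamma (1 + N%:R / 2) :> R.
Proof.
move=> N0; rewrite -lte_fin Gamma_half_integral//.
apply: (@lt_le_trans _ _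
    (\int[lam]_(t in `[1%R, 2%R]%classic) (expR (-2))%:E)%E).
  rewrite integral_cst//=.
  rewrite lebesgue_measure_itv/= lte_fin ltr1n.
  by rewrite -EFinB -EFinM lte_fin mulr_gt0 ?expR_gt0//; lra.
apply: (@le_trans _ _
  (\int[lam]_(t in `[1%R, 2%R]%classic) (t `^ (N%:R / 2) * expR (- t))%:E)%E).
  apply: ge0_le_integral => //.
  - exact: measurable_gamma.
  - move=> t; rewrite /= in_itv/= => /andP[t1 t2]; rewrite lee_fin.
    rewrite -[leLHS]mul1r ler_pM ?expR_ge0// ?ler_expR ?lerN2//.
    by rewrite -[leLHS](powRr0 t); apply: ler_powR => //; rewrite divr_ge0.
apply: ge0_subset_integral => //.
- exact: measurable_gamma.
- by move=> t _; rewrite lee_fin mulr_ge0 ?powR_ge0 ?expR_ge0.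
- by move=> t; rewrite /= !in_itv/= andbT => /andP[t1 _]; exact: lt_le_trans t1.
Qed.

Lemma omega_gt0 (N : nat) : (0 < N)%N -> 0 < omega N :> R.
Proof. by move=> N0; rewrite divr_gt0 ?powR_gt0 ?pi_gt0// Gamma_half_gt0. Qed.

Lemma omega_Gamma (N : nat) : (0 < N)%N ->
  omega N * Gamma (1 + N%:R / 2) = pi `^ (N%:R / 2) :> R.
Proof. by move=> N0; rewrite divfK// gt_eqF// Gamma_half_gt0. Qed.

End gamma_integral.

(** * Density of the Hausdorff measure *)

Section density.
Context {R : realType} {X : pmetricType R}.
Variables (m : {measure set (borel X) -> \bar R}) (N : nat).
Hypothesis N_gt0 : (0 < N)%N.
Let omega_N_gt0 : 0 < omega N :> R := omega_gt0 N_gt0.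

Let le_expe (x : \bar R) (a K : R) :
  (0 <= x -> x <= a%:E -> 0 <= K%:E -> K%:E * x ^+ N <= (K * a ^+ N)%:E)%E.
Proof.
case: x => [x||]//; rewrite !lee_fin => x0 xa K0.
by rewrite -EFin_expe -EFinM lee_fin ler_wpM2l// lerXn2r// nnegrE (le_trans x0).
Qed.

Let term_le (x : X) (r : R) :
  ((omega N / 2 ^+ N)%:E * diam (clball x r) ^+ N <=
   (omega N * Num.max r 0 ^+ N)%:E)%E.
Proof.
apply: le_trans (le_expe _ (diam_clball x r) _) _.
- by rewrite /diam le_max lexx.
- by rewrite lee_fin divr_ge0// ?exprn_ge0// ltW.
- by rewrite lee_fin exprMn mulrA divfK// expf_neq0.
Qed.

(** The disjoint balls B_k of a Vitali sequence satisfy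
    omega_N r_k^N <= (omega_N / c) m(B_k), so the sum of the left-hand sides is
    at most (omega_N / c) m(U).  This convergent sum forces r_k to tend to 0, and
    the price 3^N for tripling all balls from the n-th on is paid only on a tail
    of the series. *)
Lemma hausdorff_pre_le_dense_balls (U : set X) (c eta : R) :
  0 < c -> 0 < eta -> open U -> (m U < +oo)%E ->
  (forall y r0, U y -> 0 < r0 ->
     exists2 r, 0 < r < r0 & ((c * r ^+ N)%:E <= m (clball y r))%E) ->
  (hausdorff_pre N (6 * eta) U <= (omega N / c)%:E * m U)%E.
Proof.
move=> c0 eta0 oU mUy bad.
pose F : set (X * R) := [set p | [/\ 0 < p.2 <= eta, clball p.1 p.2 `<=` U &
  ((c * p.2 ^+ N)%:E <= m (clball p.1 p.2))%E]].
have F_le p : F p -> 0 < p.2 <= eta by case.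
have [P [FP tP coverP]] := vitali_sequence F_le.
pose B k := clball (P k).1 (P k).2.
pose e k : \bar R := (omega N * Num.max (P k).2 0 ^+ N)%:E.
have e0 k : (0 <= e k)%E.
  by rewrite lee_fin mulr_ge0 ?(ltW omega_N_gt0)// exprn_ge0// le_max lexx orbT.
have BU k : B k `<=` U.
  by case: (FP k) => [[]//|r0]; rewrite /B (clball_lt0 _ r0).
have mB k : measurable (B k : set (borel X)) by exact: measurable_clball.
have oc0 : (0 <= (omega N / c)%:E)%E by rewrite lee_fin divr_ge0// ltW.
have eB k : (e k <= (omega N / c)%:E * m (B k))%E.
  rewrite /e; case: (FP k) => [[/andP[r0 _] _ h]|r0].
    rewrite max_l ?(ltW r0)//.
    apply: le_trans (lee_wpmul2l oc0 h).
    by rewrite -EFinM lee_fin mulrA divfK// gt_eqF.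
  rewrite max_r ?(ltW r0)// expr0n -[(N == 0)%N]negbK -lt0n N_gt0/= mulr0.
  by rewrite mule_ge0.
have sum_e : (\sum_(k <oo) e k <= (omega N / c)%:E * m U)%E.
  apply: (@le_trans _ _ (\sum_(k <oo) (omega N / c)%:E * m (B k))%E).
    by apply: lee_nneseries => // k _; exact: eB.
  rewrite nneseriesZl//; apply: lee_wpmul2l => //.
  rewrite -measure_semi_bigcup//; last exact: bigcup_measurable.
  apply: le_measure; rewrite ?inE.
  - exact: bigcup_measurable.
  - exact: open_measurableX.
  - by move=> z [k _]; exact: BU.
have sum_lty : (\sum_(k <oo) e k < +oo)%E.
  apply: (le_lt_trans sum_e); exact: lte_mul_pinfty.
have max3 (r : R) : Num.max (3 * r) 0 = 3 * Num.max r 0.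
  by rewrite maxr_pMr// mulr0.
have tail0 : (\sum_(n <= k <oo) e k)%E @[n --> \oo] --> 0%E.
  exact: nneseries_tail_cvg.
have tail_lt (a : R) : 0 < a -> exists n, (\sum_(n <= k <oo) e k < a%:E)%E.
  move=> a0; have : nbhs (0 : \bar R)%E [set x | (x < a%:E)%E].
    by apply: open_nbhs_nbhs; split; [exact: open_ereal_lt_ereal|rewrite /=
      lte_fin].
  by move=> /tail0[n _ hn]; exists n; exact: (hn n (leqnn n)).
have small a : 0 < a -> exists n, forall k, (n <= k)%N -> (P k).2 < a.
  move=> a0; have [n hn] := tail_lt _ (mulr_gt0 omega_N_gt0 (exprn_gt0 N a0)).
  exists n => k nk; rewrite ltNge; apply/negP => ak.
  have : (e k <= \sum_(n <= j <oo) e j)%E.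
    apply: le_trans (nneseries_lim_ge k.+1 _) => //.
    rewrite big_nat_recr//= leeDr//; exact: sume_ge0.
  move=> /le_lt_trans/(_ hn); rewrite lte_fin ltr_pM2l// ltNge => /negP; apply.
  by rewrite lerXn2r// ?nnegrE ?le_max ?ak ?(ltW a0)// (le_trans (ltW a0) ak).
apply/lee_addgt0Pr => eps eps0.
have e3 : 0 < eps / 3 ^+ N by rewrite divr_gt0// exprn_gt0.
have [n /ltW hn] := tail_lt _ e3.
pose E k := if (k < n)%N then B k else clball (P k).1 (3 * (P k).2).
apply: (@le_trans _ _
    (\sum_(k <oo) ((omega N / 2 ^+ N)%:E * diam (E k) ^+ N))%E).
  apply: ereal_inf_lbound; exists E => //; split.
  - move=> y Uy; have [[k kn By]|nB] := pselect (exists2 k, (k < n)%N & B k y).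
      by exists k => //; rewrite /E kn.
    have oV : open (U `&` ~` \bigcup_(k in `I_n) B k).
      apply: openI => //; apply: closed_openC; apply: closed_bigcup.
        exact: finite_II.
      by move=> k _; exact: closed_clball.
    have /nbhs_ballP[r1 /= r10 hr1] : nbhs y (U `&` ~` \bigcup_(k in `I_n) B k).
      by apply: open_nbhs_nbhs; split.
    have r20 : 0 < Num.min r1 eta by rewrite lt_min r10.
    have [r /andP[r0]] := bad y _ Uy r20.
    rewrite lt_min => /andP[rr1 reta] hr.
    have sub : clball y r `<=` ball y r1.
      by move=> z; rewrite ballEmdist /clball/= => /le_lt_trans; exact.
    have Fy : F (y, r).
      split => //=; first by rewrite r0 ltW.
      by move=> z /sub/hr1[].
    have [|k nk hk] := coverP small n _ Fy.
      move=> k kn; apply/seteqP; split => // z [/sub/hr1[_ h] Bz].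
      by apply: h; exists k.
    by exists k => //; rewrite /E ltnNge nk.
  - have P_le k : Num.max (P k).2 0 <= eta.
      rewrite ge_max (ltW eta0) andbT.
      by case: (FP k) => [[/andP[]]//|r0]; apply: ltW; exact: lt_trans eta0.
    move=> k; rewrite /E; case: ifPn => _; apply: (le_trans (diam_clball _ _)).
      by rewrite lee_fin; have := P_le k; lra.
    rewrite lee_fin; have := P_le k.
    by rewrite max3; lra.
have term_ge0 k : (0 <= (omega N / 2 ^+ N)%:E * diam (E k) ^+ N)%E.
  apply: mule_ge0; last by rewrite expe_ge0// /diam le_max lexx.
  by rewrite lee_fin; apply: divr_ge0; [exact: ltW|exact: exprn_ge0].
rewrite (nneseries_split 0 n)// add0n; apply: leeD.
  apply: (le_trans _ sum_e); apply: le_trans (nneseries_lim_ge n _) => //.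
  rewrite big_nat_cond [leRHS]big_nat_cond.
  by apply: lee_sum => k /andP[/andP[_ kn] _]; rewrite /E kn; exact: term_le.
apply: (@le_trans _ _ (\sum_(n <= k <oo) (3 ^+ N)%:E * e k)%E).
  rewrite -nneseries_addn; last by move=> k; exact: term_ge0.
  rewrite -[leRHS]nneseries_addn; last by move=> k; rewrite mule_ge0// lee_fin
    exprn_ge0.
  apply: lee_nneseries => k _; first by move=> _; exact: term_ge0.
  rewrite /E ltnNge leq_addl/=; apply: le_trans (term_le _ _) _.
  rewrite /e -EFinM lee_fin mulrCA ler_wpM2l ?(ltW omega_N_gt0)//.
  by rewrite -exprMn max3.
rewrite nneseriesZl//; apply: le_trans (lee_wpmul2l _ hn) _.
  by rewrite lee_fin exprn_ge0.
by rewrite -EFinM lee_fin mulrC divfK// expf_neq0.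
Qed.
End density.

Section density_point.
Context {R : realType} {X : pmetricType R}.
Variables (m : {measure set (borel X) -> \bar R}) (N : nat).
Hypothesis N_gt0 : (0 < N)%N.
Let omega_N_gt0 : 0 < omega N :> R := omega_gt0 N_gt0.
Hypothesis mE : forall A : set (borel X), measurable A ->
  m A = hausdorff N (A : set X).

(** Otherwise [hausdorff_pre_le_dense_balls] applies at every scale and bounds
    the Hausdorff measure of U, which is m(U), by m(U) / a. *)
Lemma exists_small_density (U : set X) (a : R) :
  1 < a -> open U -> (0 < m U < +oo)%E ->
  exists y, U y /\ exists2 r0, 0 < r0 &
    forall r, 0 < r < r0 -> (m (clball y r) <= (a * omega N * r ^+ N)%:E)%E.
Proof.
move=> a1 oU /andP[mU0 mUy]; apply: contrapT => nex.
have a0 : 0 < a by exact: lt_trans a1.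
have c0 : 0 < a * omega N by rewrite mulr_gt0.
have bad y r0 : U y -> 0 < r0 ->
    exists2 r, 0 < r < r0 & ((a * omega N * r ^+ N)%:E <= m (clball y r))%E.
  move=> Uy r00; apply: contrapT => nr; apply: nex; exists y; split => //.
  exists r0 => // r rr; rewrite leNgt; apply/negP => /ltW h.
  by apply: nr; exists r.
have : (hausdorff N U <= a^-1%:E * m U)%E.
  apply: ge_ereal_sup => _ [d /= d0 <-].
  have d6 : 0 < d / 6 by rewrite divr_gt0.
  have := hausdorff_pre_le_dense_balls N_gt0 c0 d6 oU mUy bad.
  by rewrite [6 * _]mulrC divfK// invfM mulrCA mulfV ?gt_eqF// mulr1.
rewrite -mE; last exact: open_measurableX.
have /fineK <- : m U \is a fin_num by rewrite ge0_fin_numE// ltW.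
have mf0 : 0 < fine (m U) by rewrite fine_gt0// mU0.
rewrite -EFinM lee_fin -[leLHS]mul1r ler_pM2r// leNgt => /negP; apply.
by rewrite invf_lt1.
Qed.

End density_point.

(** * Gaussian integrals and volume growth *)

Section gaussian.
Context {R : realType} {X : pmetricType R}.
Local Notation lam := (@lebesgue_measure R).
Implicit Types (y z : X).

Lemma measurable_gauss (c : R) y (D : set (borel X)) :
  measurable_fun D ((fun z => expR (- c * mdist y z ^+ 2)) : borel X -> R).
Proof.
apply: measurable_funTS; apply: measurableT_comp => //.
apply: measurable_funM => //; apply: measurable_funX; exact: measurable_mdist.
Qed.

(** Writing exp (- c d^2) as the integral of exp (- u) over u >= c d^2 and
    exchanging the integrals leaves the integral of
    mu(B(y, sqrt (u / c))) exp (- u), a Gamma integral once the growth bound is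
    inserted. *)
Lemma gauss_integral_le_of_growth (mu : {finite_measure set (borel X) -> \bar
  R})
    (y : X) (N : nat) (K c : R) : (0 < N)%N -> 0 <= K -> 0 < c ->
  (forall s, 0 < s -> (mu (clball y s) <= (K * s ^+ N)%:E)%E) ->
  (\int[mu]_z (expR (- c * mdist y z ^+ 2))%:E <=
   (K * Gamma (1 + N%:R / 2) * c^-1 `^ (N%:R / 2))%:E)%E.
Proof.
move=> N0 K0 c0 growth.
pose A : set (borel X * R) := [set p | 0 < p.2 /\ c * mdist y p.1 ^+ 2 <= p.2].
pose f (p : borel X * R) : \bar R := (expR (- p.2) * \1_A p)%:E.
have mdist2 : measurable_fun [set: borel X * R]
    ((fun p => p.2 - c * mdist y p.1 ^+ 2) : borel X * R -> R).
  apply: measurable_funB => //; apply: measurable_funM => //.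
  apply: measurable_funX; apply: measurableT_comp => //; exact:
    measurable_mdist.
have mA : measurable A.
  rewrite (_ : A = (snd @^-1` `]0, +oo[%classic) `&`
      (fun p : borel X * R => p.2 - c * mdist y p.1 ^+ 2) @^-1` `[0,
        +oo[%classic).
    apply: measurableI.
      rewrite -[X in measurable X]setTI; exact: measurable_snd.
    by rewrite -[X in measurable X]setTI; exact: mdist2.
  by apply/seteqP; split => p; rewrite /A /= !in_itv/= !andbT subr_ge0.
have f0 p : (0 <= f p)%E by rewrite lee_fin mulr_ge0 ?expR_ge0.
have mf : measurable_fun setT f.
  apply/measurable_EFinP; apply: measurable_funM; last exact: measurable_indic.
  by do 2 apply: measurableT_comp => //.
have inner z : ((expR (- c * mdist y z ^+ 2))%:E <= \int[lam]_u f (z, u))%E.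
  rewrite mulNr -integral_expRN_itvy -integral_itv_obnd_cbnd; last first.
    by apply/measurable_EFinP; apply: measurable_funTS; apply: measurableT_comp.
  rewrite [leLHS]integral_mkcond; apply: ge0_le_integral => //.
  - by move=> u _; apply: erestrict_ge0 => x _; rewrite lee_fin expR_ge0.
  - apply/(measurable_restrictT _ _).1 => //.
    by apply/measurable_EFinP; apply: measurable_funTS; apply: measurableT_comp.
  - by apply: (measurableT_comp mf); exact: pair1_measurable.
  - move=> u _; rewrite patchE; case: ifPn => // uz.
    move: uz; rewrite inE/= in_itv/= andbT => uz.
    rewrite lee_fin indicE mem_set ?mulr1//=; split => /=; last exact: ltW.
    by apply: le_lt_trans uz; rewrite mulr_ge0 ?sqr_ge0// ltW.
apply: (@le_trans _ _ (\int[mu]_z \int[lam]_u f (z, u))%E).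
  apply: ge0_le_integral => //.
  - by apply/measurable_EFinP; exact: measurable_gauss.
  - exact: (@measurable_fun_fubini_tonelli_F _ _ _ _ _ lam f).
rewrite [leLHS](@fubini_tonelli _ _ _ _ _ mu lam f mf f0).
have mgam : measurable_fun [set: R] (fun u : R =>
    ((u `^ (N%:R / 2) * expR (- u))%:E : \bar R)).
  apply/measurable_EFinP; apply: measurable_funM; first exact: measurable_powR.
  exact: measurableT_comp.
have -> : (K * Gamma (1 + N%:R / 2) * c^-1 `^ (N%:R / 2))%:E =
    (\int[lam]_(u in `]0%R, +oo[%classic)
      ((K * c^-1 `^ (N%:R / 2))%:E * (u `^ (N%:R / 2) * expR (- u))%:E))%E.
  rewrite ge0_integralZl//.
  - by rewrite -Gamma_half_integral// -EFinM mulrAC.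
  - exact: measurable_funTS.
  - by move=> u _; rewrite lee_fin mulr_ge0 ?powR_ge0 ?expR_ge0.
  - by rewrite lee_fin mulr_ge0// powR_ge0.
rewrite [leRHS]integral_mkcond; apply: ge0_le_integral => //.
- by move=> u _; apply: integral_ge0.
- exact: (@measurable_fun_fubini_tonelli_G _ _ _ _ _ mu f).
- apply/(measurable_restrictT _ _).1 => //; apply: measurable_funTS.
  by apply: emeasurable_funM.
- move=> u _; rewrite patchE /=; case: ifPn => [|nu]; last first.
    rewrite integral0_eq// => z _; rewrite /f indicE memNset ?mulr0//=.
    by move=> [u0 _]; move: nu; rewrite notin_setE/= in_itv/= andbT.
  rewrite inE/= in_itv/= andbT => u0.
  rewrite (_ : (fun z => f (z, u)) = (fun z => (expR (- u))%:E *
      (\1_(clball y (Num.sqrt (u / c))) z)%:E)%E); last first.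
    apply/funext => z; rewrite /f EFinM /=; congr (_ * (nat_of_bool _)%:R%:E)%E.
    apply/idP/idP => /set_mem h; apply: mem_set; move: h; rewrite /A /clball /=.
      move=> [_]; rewrite -ler_pdivlMl// => h; rewrite -(@ler_pXn2r _ 2)//
        ?nnegrE ?mdist_ge0//.
      by rewrite sqr_sqrtr ?divr_ge0// ?(ltW c0) ?(ltW u0)// mulrC.
    move=> h; split => //; move: h.
    rewrite -(@ler_pXn2r _ 2)// ?nnegrE ?mdist_ge0// sqr_sqrtr ?divr_ge0//
      ?(ltW c0) ?(ltW u0)//.
    by rewrite ler_pdivlMr// mulrC.
  rewrite ge0_integralZl//; last first.
    by apply/measurable_EFinP; apply: measurable_indic; exact:
      measurable_clball.
  rewrite integral_indic//; last exact: measurable_clball.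
  have s0 : 0 < Num.sqrt (u / c) by rewrite sqrtr_gt0 divr_gt0.
  rewrite setIT; apply: (le_trans (lee_wpmul2l _ (growth _ s0))).
    by rewrite lee_fin expR_ge0.
  rewrite -!EFinM lee_fin -powR_mulrn ?sqrtr_ge0// -powR12_sqrt ?divr_ge0 ?(ltW
    u0) ?(ltW c0)//.
  rewrite -powRrM powRM ?invr_ge0 ?(ltW u0) ?(ltW c0)// [2^-1 * _]mulrC.
  by rewrite le_eqVlt; apply/orP; left; apply/eqP; ring.
Qed.

End gaussian.

Section gaussian_near_point.
Context {R : realType} {X : pmetricType R}.
Variable m : {measure set (borel X) -> \bar R}.
Implicit Types (y z : X).

(** The integral over B(y, r1) sees only balls of radius less than r0; outside,
    the weight is at most exp (- (c - C) r1^2) times the integrable weight with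
    parameter C. *)
Lemma gauss_integral_le (y : X) (N : nat) (a r0 r1 C M c : R) :
  (0 < N)%N -> 0 <= a -> 0 < r1 < r0 -> 0 < C < c ->
  (forall r, 0 < r < r0 -> (m (clball y r) <= (a * omega N * r ^+ N)%:E)%E) ->
  (\int[m]_z (expR (- C * mdist y z ^+ 2))%:E <= M%:E)%E ->
  (\int[m]_z (expR (- c * mdist y z ^+ 2))%:E <=
   (a * (pi / c) `^ (N%:R / 2) + M * expR (- (c - C) * r1 ^+ 2))%:E)%E.
Proof.
move=> N0 a0 /andP[r10 r1r0] /andP[C0 Cc] growth hM.
have c0 : 0 < c by exact: lt_trans Cc.
have om0 : 0 < omega N :> R by exact: omega_gt0.
have aom0 : 0 <= a * omega N by apply: mulr_ge0 => //; exact: ltW.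
set B := clball y r1.
have mB : measurable (B : set (borel X)) by exact: measurable_clball.
have mBr1 : (m B <= (a * omega N * r1 ^+ N)%:E)%E by apply: growth; rewrite r10.
have mBy : (m B < +oo)%E by apply: (le_lt_trans mBr1); rewrite ltry.
rewrite -(setUv B) ge0_integral_setU//; last 3 first.
- exact: measurableC.
- by apply/measurable_EFinP; exact: measurable_gauss.
- exact/disj_setPCl.
rewrite EFinD; apply: leeD.
  pose mu : {finite_measure set (borel X) -> \bar R} := mfrestr mB mBy.
  rewrite (@eq_measure_integral _ _ _ _ mu); last first.
    by move=> A mA AB; rewrite /mu /= /mfrestr /mrestr setIidl.
  apply: (@le_trans _ _ (\int[mu]_z (expR (- c * mdist y z ^+ 2))%:E)%E).
    apply: ge0_subset_integral => //.
    by apply/measurable_EFinP; exact: measurable_gauss.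
  apply: le_trans (@gauss_integral_le_of_growth _ _ mu y N (a * omega N) c N0 _
    c0 _) _.
  - exact: aom0.
  - move=> s s0; rewrite /mu /= /mfrestr /mrestr.
    have [sr0|r0s] := ltP s r0.
      apply: le_trans (growth s _); last by rewrite s0.
      by apply: le_measure; rewrite ?inE//; [apply: measurableI => //|];
        exact: measurable_clball.
    apply: (@le_trans _ _ (m B)).
      apply: le_measure; rewrite ?inE//; apply: measurableI => //.
      exact: measurable_clball.
    apply: (le_trans mBr1); rewrite lee_fin ler_wpM2l//.
    rewrite lerXn2r ?nnegrE ?(ltW s0) ?(ltW r10)//.
    by apply: ltW; exact: lt_le_trans r0s.
  - rewrite lee_fin -[_ * omega N * _]mulrA omega_Gamma// -mulrA -powRM//.
      exact: pi_ge0.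
    by rewrite invr_ge0 ltW.
have -> : (M * expR (- (c - C) * r1 ^+ 2))%:E =
  ((expR (- (c - C) * r1 ^+ 2))%:E * M%:E)%E by rewrite -EFinM mulrC.
apply: le_trans (lee_wpmul2l _ hM); last by rewrite lee_fin expR_ge0.
rewrite -ge0_integralZl//; last first.
  by apply/measurable_EFinP; exact: measurable_gauss.
apply: (@le_trans _ _ (\int[m]_(z in ~` B)
  ((expR (- (c - C) * r1 ^+ 2))%:E * (expR (- C * mdist y z ^+ 2))%:E))%E).
  apply: ge0_le_integral => //.
  - exact: measurableC.
  - by apply/measurable_EFinP; exact: measurable_gauss.
  - apply: emeasurable_funM => //.
    by apply/measurable_EFinP; exact: measurable_gauss.
  - move=> z; rewrite /B /clball /= => /negP; rewrite -ltNge => r1z.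
    rewrite -EFinM lee_fin -expRD ler_expR.
    have : r1 ^+ 2 <= mdist y z ^+ 2.
      by rewrite lerXn2r ?nnegrE ?mdist_ge0 ?(ltW r10) ?ltW.
    have : 0 <= c - C by rewrite subr_ge0 ltW.
    by move=> /ler_wpM2l/[apply]; lra.
apply: ge0_subset_integral => //.
- exact: measurableC.
- apply: emeasurable_funM => //.
  by apply/measurable_EFinP; exact: measurable_gauss.
Qed.

(** d^2(x, .) <= 2 d^2(x, y) + 2 d^2(y, .), so doubling the exponent pays for
    the change of centre. *)
Lemma gauss_integrable_moved (C : R) (x y : X) : 0 < C ->
  (\int[m]_z (expR (- C * mdist x z ^+ 2))%:E < +oo)%E ->
  (\int[m]_z (expR (- (2 * C) * mdist y z ^+ 2))%:E < +oo)%E.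
Proof.
move=> C0 fin.
apply: (@le_lt_trans _ _ ((expR (2 * C * mdist x y ^+ 2))%:E *
   \int[m]_z (expR (- C * mdist x z ^+ 2))%:E)%E); last first.
  by rewrite lte_mul_pinfty// lee_fin expR_ge0.
rewrite -ge0_integralZl//; last first.
  by apply/measurable_EFinP; exact: measurable_gauss.
apply: ge0_le_integral => //.
- by apply/measurable_EFinP; exact: measurable_gauss.
- apply: emeasurable_funM => //.
  by apply/measurable_EFinP; exact: measurable_gauss.
- move=> z _; rewrite -EFinM lee_fin -expRD ler_expR.
  have : mdist x z <= mdist x y + mdist y z by exact: metric_triangle.
  have := mdist_ge0 x z.
  move: (mdist x z) (mdist x y) (mdist y z) => u v w u0 uvw.
  have : u ^+ 2 <= 2 * v ^+ 2 + 2 * w ^+ 2.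
    have : u ^+ 2 <= (v + w) ^+ 2 by rewrite lerXn2r// nnegrE// (le_trans u0).
    by have := sqr_ge0 (v - w); nra.
  by nra.
Qed.

End gaussian_near_point.

(** * Entropy and second moment *)

Section entropy_lower_bound.
Context {R : realType} {X : pmetricType R}.
Implicit Types (m : {measure set (borel X) -> \bar R}).
Implicit Types (mu : probability (borel X) R).
Local Open Scope ereal_scope.

Import HBNNSimple.

(** Both sides commute with increasing limits, so it suffices to treat simple
    functions, where it is the definition of a density. *)
Lemma integral_density m mu (rho : X -> R) (f : borel X -> \bar R) :
  is_density m mu rho -> (forall x, 0 <= f x) -> measurable_fun setT f ->
  \int[mu]_x f x = \int[m]_x (f x * (rho x)%:E).
Proof.
move=> [mrho rho0 murho] f0 mf.
have mrhoE : measurable_fun [set: borel X] (fun x : borel X => (rho x)%:E).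
  exact/measurable_EFinP.
pose h := nnsfun_approx measurableT mf.
have hf x : (EFin \o h n) x @[n --> \oo] --> f x.
  exact: cvg_nnsfun_approx.
have -> : \int[mu]_x f x = lim (\int[mu]_x (EFin \o h n) x @[n --> \oo]).
  have fE x : f x = lim ((EFin \o h n) x @[n --> \oo]).
    by apply/esym/cvg_lim.
  under eq_integral => x _ do rewrite fE.
  apply: monotone_convergence => //.
  - by move=> n; apply/measurable_EFinP.
  - by move=> n x _; rewrite lee_fin.
  - by move=> x _ a b ab; rewrite lee_fin; exact/lefP/nd_nnsfun_approx.
have -> : \int[m]_x (f x * (rho x)%:E) =
    lim (\int[m]_x ((EFin \o h n) x * (rho x)%:E) @[n --> \oo]).
  have fE x : f x * (rho x)%:E =
      lim (((EFin \o h n) x * (rho x)%:E) @[n --> \oo]).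
    by apply/esym/cvg_lim => //; exact: cvgeZr.
  under eq_integral => x _ do rewrite fE.
  apply: monotone_convergence => //.
  - by move=> n; apply: emeasurable_funM => //; exact/measurable_EFinP.
  - by move=> n x _; rewrite mule_ge0// lee_fin.
  - move=> x _ a b ab; rewrite lee_wpmul2r ?lee_fin//.
    exact/lefP/nd_nnsfun_approx.
congr (lim (_ @[n --> \oo])); apply/funext => n.
transitivity (\int[mu]_x
   (\sum_(y \in range (h n)) (y * \1_(h n @^-1` [set y]) x)%:E)).
  by apply: eq_integral => t tE; rewrite /= fimfunE -fsumEFin.
have mi r : measurable_fun setT
    (fun x : borel X => (r * \1_(h n @^-1` [set r]) x)%:E).
  by apply: (measurable_comp measurableT) => //; exact: measurable_funM.
rewrite ge0_integral_fsum//; last by move=> k y _; exact: nnfun_muleindic_ge0.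
transitivity (\int[m]_x (\sum_(y \in range (h n))
    (y * \1_(h n @^-1` [set y]) x)%:E * (rho x)%:E)); last first.
  apply: eq_integral => x _.
  rewrite -ge0_mule_fsuml => [|y]; last exact: nnfun_muleindic_ge0.
  by rewrite fsumEFin // -(fimfunE _ x).
rewrite ge0_integral_fsum//; last 2 first.
  - by move=> y; exact: emeasurable_funM.
  - move=> k y _; apply: mule_ge0; last by rewrite lee_fin.
    exact: nnfun_muleindic_ge0.
apply: eq_fsbigr => r rhn.
under eq_integral do rewrite EFinM.
rewrite integralZl_indic_nnsfun => //.
rewrite integral_indic// setIT.
transitivity (r%:E * \int[m]_(x in h n @^-1` [set r]) (rho x)%:E).
  by congr (_ * _); exact: murho.
under [RHS]eq_integral do rewrite EFinM -muleA.
rewrite ge0_integralZl//.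
- rewrite [in LHS]integral_mkcond; apply: (congr1 (fun e => r%:E * e)).
  apply: eq_integral => x _.
  by rewrite epatch_indic muleC.
- by apply: emeasurable_funM => //; exact/measurable_EFinP.
- by move=> t _; rewrite mule_ge0 ?lee_fin.
- by move: rhn; rewrite inE => -[t _ <-]; rewrite lee_fin.
Qed.

(** Monotonicity of the integral for an [f] that is not known to be integrable:
    the bound [g1 - g2 <= f] makes the negative part of [f] integrable, so that
    no difference of infinities occurs. *)
Lemma integral_ge_sub m (D : set (borel X)) (f g1 g2 : borel X -> R) (a b : R) :
  measurable D -> measurable_fun D f -> measurable_fun D g1 ->
  measurable_fun D g2 ->
  (forall x, D x -> 0 <= g1 x)%R -> (forall x, D x -> 0 <= g2 x)%R ->
  (forall x, D x -> g1 x <= f x + g2 x)%R ->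
  a%:E <= \int[m]_(x in D) (g1 x)%:E -> \int[m]_(x in D) (g2 x)%:E <= b%:E ->
  (a - b)%:E <= \int[m]_(x in D) (f x)%:E.
Proof.
move=> mD mf mg1 mg2 g10 g20 fg ha hb.
have mfE : measurable_fun D (fun x => (f x)%:E) by exact/measurable_EFinP.
set F := fun x => (f x)%:E; rewrite integralE -/F.
have mp : measurable_fun D F^\+ by exact: measurable_funepos.
have mn : measurable_fun D F^\- by exact: measurable_funeneg.
have nle : \int[m]_(x in D) F^\- x <= b%:E.
  apply: le_trans hb; apply: ge0_le_integral => //.
    exact/measurable_EFinP.
  move=> x Dx; rewrite funenegE /F -EFinN -EFin_max lee_fin ge_max g20// andbT.
  by have := fg x Dx; have := g10 x Dx; lra.
have nfin : \int[m]_(x in D) F^\- x \is a fin_num.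
  by rewrite ge0_fin_numE ?integral_ge0// (le_lt_trans nle)// ltry.
have : a%:E + \int[m]_(x in D) F^\- x <= \int[m]_(x in D) F^\+ x + b%:E.
  apply: (@le_trans _ _ (\int[m]_(x in D) (F^\+ x + (g2 x)%:E))); last first.
    rewrite ge0_integralD//; first exact: leeD.
    exact/measurable_EFinP.
  apply: (@le_trans _ _ (\int[m]_(x in D) ((g1 x)%:E + F^\- x))).
    rewrite ge0_integralD//; first exact: leeD.
    exact/measurable_EFinP.
  apply: ge0_le_integral => //.
  - by move=> x Dx; rewrite adde_ge0// lee_fin g10.
  - by apply: emeasurable_funD => //; exact/measurable_EFinP.
  - by apply: emeasurable_funD => //; exact/measurable_EFinP.
  - move=> x Dx; rewrite funenegE funeposE /F -EFinN -!EFin_max -!EFinD lee_fin.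
    have := fg x Dx; have := g10 x Dx; have := g20 x Dx.
    have [f0|f0] := leP 0%R (f x).
      by rewrite max_r ?oppr_le0//; lra.
    by rewrite max_l ?oppr_ge0 ?(ltW f0)//; lra.
rewrite -(fineK nfin) => h.
by rewrite leeBrDr// EFinB addeAC leeBlDr.
Qed.

(** Jensen's inequality in pointwise form: for every s > 0,
    rho ln rho >= rho ln s + rho - s, used with s = exp (- c d^2) / Z.  The
    three terms of the right-hand side integrate to at least - c V - ln Z, to 1
    and to at least - 1. *)
Lemma Ent_ge_gauss m mu (y : X) (c Z V : R) :
  (0 < c)%R -> (0 < Z)%R ->
  \int[m]_z (expR (- c * mdist y z ^+ 2))%:E <= Z%:E -> cost mu y <= V%:E ->
  (- (ln Z + c * V))%:E <= Ent m mu.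
Proof.
move=> c0 Z0 hZ hV; apply: le_ereal_inf_tmp => _ [rho dens <-].
have [mrho rho0 murho] := dens.
set D : set (borel X) := [set x | (0 < rho x)%R].
have mD : measurable D.
  rewrite (_ : D = rho @^-1` `]0%R, +oo[%classic).
    by rewrite -[X in measurable X]setTI; exact: mrho.
  by apply/seteqP; split => x; rewrite /D /= in_itv/= andbT.
have muT : \int[m]_x (rho x)%:E = 1.
  by rewrite -(probability_setT mu) [RHS]murho.
have muD : \int[m]_(x in D) (rho x)%:E = 1.
  rewrite -muT integral_mkcond; apply: eq_integral.
  move=> x _; rewrite patchE; case: ifPn => //; rewrite notin_setE /D/= =>
    /negP.
  by rewrite -leNgt => r0; apply/eqP; rewrite eqe eq_le r0 rho0.
(* Adding [K rho] to both sides makes both of them nonnegative, whatever the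
   sign of [ln Z]. *)
pose K := `|ln Z|%R.
pose g1 x := (rho x * (1 + K - ln Z))%R.
pose g2 x := (rho x * K + expR (- c * mdist y x ^+ 2) / Z +
  c * (mdist y x ^+ 2 * rho x))%R.
have KZ : (0 <= K - ln Z)%R by rewrite subr_ge0 ler_norm.
have K0 : (0 <= K)%R by exact: normr_ge0.
have md2 : measurable_fun [set: borel X] (fun x : borel X => mdist y x ^+ 2)%R.
  by apply: measurable_funX; exact: measurable_mdist.
have mg : measurable_fun [set: borel X]
    (fun x : borel X => expR (- c * mdist y x ^+ 2))%R.
  exact: measurable_gauss.
have mr2 : measurable_fun [set: borel X]
    (fun x : borel X => mdist y x ^+ 2 * rho x)%R by exact: measurable_funM.
have mg2 : measurable_fun [set: borel X] (g2 : borel X -> R).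
  apply: measurable_funD; last exact: measurable_funM.
  by apply: measurable_funD; exact: measurable_funM.
have g20 x : (0 <= g2 x)%R.
  by rewrite !addr_ge0 ?mulr_ge0 ?expR_ge0 ?invr_ge0
    ?exprn_ge0 ?mdist_ge0 ?(ltW Z0) ?(ltW c0).
rewrite (_ : - _ = (1 + K - ln Z) - (K + 1 + c * V))%R; last by ring.
apply: (@integral_ge_sub m D _ g1 g2) => //.
- apply: measurable_funTS; apply: measurable_funM => //.
  by apply: measurableT_comp => //; exact: measurable_ln.
- by apply: measurable_funTS; exact: measurable_funM.
- exact: measurable_funTS.
- by move=> x _; rewrite mulr_ge0// -addrA addr_ge0.
- move=> x; rewrite /D /= /g1 /g2 => r0.
  set e := expR _.
  have e0 : (0 < e)%R by exact: expR_gt0.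
  have eZ : (0 < e / Z / rho x)%R by rewrite !divr_gt0.
  have : (ln (e / Z / rho x) <= e / Z / rho x - 1)%R.
    rewrite -[X in (ln X)](subrK 1%R) addrC; apply: le_ln1Dx.
    by rewrite ltrBrDr addNr.
  rewrite !ln_div ?posrE ?divr_gt0// [ln e]expRK.
  move=> /(ler_wpM2l (ltW r0)); rewrite [(rho x * (e / _ / _ - 1))%R]mulrBr.
  by rewrite [(rho x * (_ / _))%R]mulrC divfK ?gt_eqF//; lra.
- rewrite /g1; under eq_integral do rewrite mulrC EFinM.
  rewrite ge0_integralZl//.
  + by rewrite muD mule1.
  + by apply: measurable_funTS; exact/measurable_EFinP.
  + by move=> x _; rewrite lee_fin.
  + by rewrite lee_fin -addrA addr_ge0.
- apply: (@le_trans _ _ (\int[m]_x (g2 x)%:E)).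
    apply: ge0_subset_integral => //; first exact/measurable_EFinP.
    by move=> x _; rewrite lee_fin.
  under eq_integral do rewrite /g2 EFinD EFinD.
  rewrite ge0_integralD//; last 4 first.
  + by move=> x _; rewrite -EFinD lee_fin addr_ge0 ?mulr_ge0 ?expR_ge0
    ?invr_ge0 ?(ltW Z0).
  + by apply: emeasurable_funD; apply/measurable_EFinP; exact: measurable_funM.
  + by move=> x _; rewrite lee_fin !mulr_ge0 ?exprn_ge0 ?mdist_ge0 ?(ltW c0).
  + by apply/measurable_EFinP; exact: measurable_funM.
  rewrite ge0_integralD//; last 4 first.
  + by move=> x _; rewrite lee_fin mulr_ge0.
  + by apply/measurable_EFinP; exact: measurable_funM.
  + by move=> x _; rewrite lee_fin mulr_ge0 ?expR_ge0 ?invr_ge0 ?(ltW Z0).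
  + by apply/measurable_EFinP; exact: measurable_funM.
  rewrite 2!EFinD; apply: leeD; first apply: leeD.
  + under eq_integral do rewrite mulrC EFinM.
    rewrite ge0_integralZl//; first by rewrite muT mule1.
      exact/measurable_EFinP.
    by move=> x _; rewrite lee_fin.
  + under eq_integral do rewrite mulrC EFinM.
    rewrite ge0_integralZl//.
    * apply: le_trans (lee_wpmul2l _ hZ) _; first by rewrite lee_fin invr_ge0
      ltW.
      by rewrite -EFinM mulVf ?gt_eqF.
    * exact/measurable_EFinP.
    * by rewrite lee_fin invr_ge0 ltW.
  + under eq_integral do rewrite EFinM.
    rewrite ge0_integralZl//.
    * rewrite EFinM; apply: lee_wpmul2l; first by rewrite lee_fin ltW.
      under eq_integral do rewrite EFinM.
      rewrite -(@integral_density m mu rho (fun x => (mdist y x ^+ 2)%:E))//.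
      + by move=> x; rewrite lee_fin exprn_ge0// mdist_ge0.
      + exact/measurable_EFinP.
    * exact/measurable_EFinP.
    * by move=> x _; rewrite lee_fin mulr_ge0 ?exprn_ge0 ?mdist_ge0.
    * by rewrite lee_fin ltW.
Qed.

End entropy_lower_bound.

(** * Second moments along couplings and geodesics *)

Section transport.
Context {R : realType} {X : pmetricType R}.
Implicit Types (m : {measure set (borel X) -> \bar R}).
Implicit Types (mu nu : probability (borel X) R) (y : X).
Local Open Scope ereal_scope.

(** The integral of a nonnegative function is a supremum over simple functions
    below it, so that [f] and [g] may fail to be measurable.  It is applied to
    the squared distance on X * X, with the product of the Borel
    sigma-algebras. *)
Lemma ge0_le_lower_integral d (T : measurableType d)
    (mu : {measure set T -> \bar R}) (f g : T -> \bar R) :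
  (forall x, 0 <= f x) -> (forall x, f x <= g x) ->
  \int[mu]_x f x <= \int[mu]_x g x.
Proof.
move=> f0 fg; rewrite !ge0_integralTE//; last by move=> x; exact: le_trans (fg
  x).
by apply: ereal_sup_le => _ [h hf <-]; exists h => // x; exact: le_trans (fg x).
Qed.

(** The triangle inequality squared, in the form of Young's inequality; with l
    tending to 0 it replaces Minkowski's inequality in L^2. *)
Lemma young_mdist (l : R) (y u v : X) : (0 < l)%R ->
  (mdist u v ^+ 2 <= (1 + l) * mdist y v ^+ 2 + (1 + l^-1) * mdist y u ^+ 2)%R.
Proof.
move=> l0; have : (mdist u v <= mdist y u + mdist y v)%R.
  by rewrite [mdist y u]metric_sym; exact: metric_triangle.
have := mdist_ge0 u v.
move: (mdist u v) (mdist y u) (mdist y v) => a b c a0 abc.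
have : (a ^+ 2 <= (b + c) ^+ 2)%R by rewrite lerXn2r// nnegrE// (le_trans a0).
move=> /le_trans; apply; rewrite -subr_ge0.
rewrite (_ : _ - _ = l^-1 * (b - l * c) ^+ 2)%R; last by field; rewrite gt_eqF.
by rewrite mulr_ge0 ?sqr_ge0// invr_ge0 ltW.
Qed.

Let measurable_sqdist y :
  measurable_fun [set: borel X] (fun z : borel X => (mdist y z ^+ 2)%:E).
Proof.
by apply/measurable_EFinP; apply: measurable_funX; exact: measurable_mdist.
Qed.

Lemma cost_ge0 mu y : 0 <= cost mu y.
Proof. by apply: integral_ge0 => z _; rewrite lee_fin exprn_ge0// mdist_ge0.
  Qed.

Lemma coupling_integral1 mu nu p y : coupling mu nu p ->
  \int[p]_z (mdist y z.1 ^+ 2)%:E = cost mu y.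
Proof.
move=> pc; rewrite /cost.
transitivity (\int[pushforward p (fst : _ -> borel X)]_z (mdist y z ^+ 2)%:E).
  rewrite (@ge0_integral_pushforward _ _ _ _ _ _ measurable_fst)//.
  by move=> z _; rewrite lee_fin exprn_ge0// mdist_ge0.
by apply: eq_measure_integral => A mA _; have [] := pc A mA.
Qed.

Lemma coupling_integral2 mu nu p y : coupling mu nu p ->
  \int[p]_z (mdist y z.2 ^+ 2)%:E = cost nu y.
Proof.
move=> pc; rewrite /cost.
transitivity (\int[pushforward p (snd : _ -> borel X)]_z (mdist y z ^+ 2)%:E).
  rewrite (@ge0_integral_pushforward _ _ _ _ _ _ measurable_snd)//.
  by move=> z _; rewrite lee_fin exprn_ge0// mdist_ge0.
by apply: eq_measure_integral => A mA _; have [] := pc A mA.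
Qed.

Definition sqW2 mu nu : \bar R :=
  ereal_inf [set \int[p]_z (@mdist R X z.1 z.2 ^+ 2)%:E
            | p in [set p | coupling mu nu p]].

Lemma sqW2_ge0 mu nu : 0 <= sqW2 mu nu.
Proof.
apply: le_ereal_inf_tmp => _ [p _ <-].
by apply: integral_ge0 => z _; rewrite lee_fin exprn_ge0// mdist_ge0.
Qed.

Lemma sqr_W2 mu nu : W2 mu nu ^+ 2 = sqW2 mu nu.
Proof. by rewrite /W2 poweR12_sqrt ?sqr_sqrte//; exact: sqW2_ge0. Qed.

(** Integrating [young_mdist], with the squared distance first replaced by a
    measurable minorant [h]. *)
Lemma cost_le_coupling mu nu p y (l : R) : (0 < l)%R -> coupling mu nu p ->
  cost nu y <= (1 + l)%:E * \int[p]_z (@mdist R X z.1 z.2 ^+ 2)%:E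
             + (1 + l^-1)%:E * cost mu y.
Proof.
move=> l0 pc; have l1 : (0 < 1 + l)%R by rewrite addr_gt0.
have il : (0 < 1 + l^-1)%R by rewrite addr_gt0// invr_gt0.
rewrite -(coupling_integral1 y pc) -(coupling_integral2 y pc).
pose h (z : borel X * borel X) : R := Num.max 0%R
  (((1 + l)^-1 * (mdist y z.2 ^+ 2 - (1 + l^-1) * mdist y z.1 ^+ 2))%R).
have h0 z : (0 <= h z)%R by rewrite le_max lexx.
have md1 : measurable_fun [set: borel X * borel X]
    (fun z : borel X * borel X => mdist y z.1 ^+ 2)%R.
  by apply: measurable_funX; apply: measurableT_comp => //; exact:
    measurable_mdist.
have md2 : measurable_fun [set: borel X * borel X]
    (fun z : borel X * borel X => mdist y z.2 ^+ 2)%R.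
  by apply: measurable_funX; apply: measurableT_comp => //; exact:
    measurable_mdist.
have mh : measurable_fun [set: borel X * borel X] h.
  apply: measurable_maxr => //; apply: measurable_funM => //.
  by apply: measurable_funB => //; exact: measurable_funM.
apply: (@le_trans _ _ ((1 + l)%:E * \int[p]_z (h z)%:E +
    (1 + l^-1)%:E * \int[p]_z (mdist y z.1 ^+ 2)%:E)); last first.
  rewrite leeD2r//; apply: lee_wpmul2l; first by rewrite lee_fin ltW.
  apply: ge0_le_lower_integral => z; rewrite lee_fin// ge_max exprn_ge0
    ?mdist_ge0//=.
  rewrite ler_pdivrMl// lerBlDr.
  by have := young_mdist z.1 y z.2 l0; rewrite [mdist z.1 y]metric_sym.
rewrite -ge0_integralZl//; last 3 first.
- exact/measurable_EFinP.
- by move=> z _; rewrite lee_fin.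
- by rewrite lee_fin ltW.
rewrite -ge0_integralZl//; last 3 first.
- exact/measurable_EFinP.
- by move=> z _; rewrite lee_fin exprn_ge0// mdist_ge0.
- by rewrite lee_fin ltW.
rewrite -ge0_integralD//; last 4 first.
- by move=> z _; rewrite mule_ge0 ?lee_fin// ltW.
- by apply: emeasurable_funM => //; exact/measurable_EFinP.
- by move=> z _; rewrite mule_ge0 ?lee_fin ?exprn_ge0 ?mdist_ge0// ltW.
- by apply: emeasurable_funM => //; exact/measurable_EFinP.
apply: ge0_le_lower_integral => z; first by rewrite lee_fin exprn_ge0//
  mdist_ge0.
rewrite -!EFinM -EFinD lee_fin -lerBlDr -ler_pdivrMl//.
by rewrite le_max lexx orbT.
Qed.

(** The cost of the product coupling. *)
Lemma sqW2_le mu nu y (l : R) : (0 < l)%R ->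
  sqW2 mu nu <= (1 + l)%:E * cost nu y + (1 + l^-1)%:E * cost mu y.
Proof.
move=> l0; have l1 : (0 < 1 + l)%R by rewrite addr_gt0.
have il : (0 < 1 + l^-1)%R by rewrite addr_gt0// invr_gt0.
have pc : coupling mu nu (mu \x nu)%E.
  move=> A mA; rewrite -[fst @^-1` A]setXT -[snd @^-1` A]setTX; split.
    by rewrite [LHS]product_measure1E// [X in _ * X]probability_setT mule1.
  by rewrite [LHS]product_measure1E// [X in X * _]probability_setT mul1e.
apply: (@le_trans _ _ (\int[(mu \x nu)%E]_z (@mdist R X z.1 z.2 ^+ 2)%:E)).
  by apply: ereal_inf_lbound; exists (mu \x nu)%E.
have md1 : measurable_fun [set: borel X * borel X]
    (fun z : borel X * borel X => (mdist y z.1 ^+ 2)%:E).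
  exact: (measurableT_comp (measurable_sqdist y) measurable_fst).
have md2 : measurable_fun [set: borel X * borel X]
    (fun z : borel X * borel X => (mdist y z.2 ^+ 2)%:E).
  exact: (measurableT_comp (measurable_sqdist y) measurable_snd).
rewrite -(coupling_integral1 y pc) -(coupling_integral2 y pc).
have sq0 (a b : X) : 0 <= (mdist a b ^+ 2)%:E :> \bar R.
  by rewrite lee_fin exprn_ge0// mdist_ge0.
have l10 : 0 <= (1 + l)%:E by rewrite lee_fin ltW.
have il0 : 0 <= (1 + l^-1)%:E by rewrite lee_fin ltW.
rewrite -ge0_integralZl// -ge0_integralZl// -ge0_integralD//; last 4 first.
- by move=> z _; exact: mule_ge0.
- exact: emeasurable_funM.
- by move=> z _; exact: mule_ge0.
- exact: emeasurable_funM.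
apply: ge0_le_lower_integral => z; first exact: sq0.
by rewrite -!EFinM -EFinD lee_fin; exact: young_mdist.
Qed.

End transport.

Section uniform_ball.
Context {R : realType} {X : pmetricType R}.
Variable m : {measure set (borel X) -> \bar R}.
Local Open Scope ereal_scope.

(** The uniform measure on the ball: its density takes a single positive value. *)
Lemma exists_concentrated (P : probability (borel X) R) (y : X) (r : R) :
  0 < m (ball y r) < +oo ->
  exists mu : probability (borel X) R,
    cost mu y <= (r ^+ 2)%:E /\ Ent m mu < +oo.
Proof.
set B : set (borel X) := ball y r => /andP[mB0 mBy].
have mB : measurable (B : set (borel X)) by exact: measurable_mball.
pose k : R := ((fine (m B))^-1)%R.
have mBf0 : (0 < fine (m B))%R by rewrite fine_gt0// mB0.
have k0 : (0 < k)%R by rewrite invr_gt0.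
(* [P] would be the value of [mnormalize] if [m B] were 0 or infinite. *)
pose mu : probability (borel X) R := mnormalize (mrestr m mB) P.
have muE A : mu A = k%:E * m (A `&` B).
  have mT : mrestr m mB [set: borel X] = m B by rewrite /mrestr setTI.
  transitivity ((if (m B == 0) || (m B == +oo) then fun U => P U
      else fun U => mrestr m mB U * ((fine (m B))^-1)%:E) A).
    by rewrite -mT.
  by rewrite gt_eqF//= lt_eqF//= muleC.
pose rho (x : X) : R := (k * \1_B x)%R.
have rho0 x : (0 <= rho x)%R by rewrite mulr_ge0// ltW.
have mrho : measurable_fun [set: borel X] (rho : borel X -> R).
  by apply: measurable_funM => //; exact: measurable_indic.
have dens : is_density m mu rho.
  split => // A mA; rewrite muE /rho.
  under eq_integral do rewrite EFinM.
  rewrite ge0_integralZl//; last 2 first.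
  - by apply/measurable_EFinP; exact: measurable_indic.
  - by rewrite lee_fin ltW.
  by rewrite integral_indic// setIC.
exists mu; split.
  rewrite /cost (integral_density dens); last 2 first.
  - by move=> x; rewrite lee_fin exprn_ge0// mdist_ge0.
  - by apply/measurable_EFinP; apply: measurable_funX; exact: measurable_mdist.
  have -> : (r ^+ 2)%:E = \int[m]_x ((r ^+ 2)%:E * (rho x)%:E).
    rewrite ge0_integralZl//.
    - have [_ _ /(_ _ measurableT) <-] := dens.
      by rewrite probability_setT mule1.
    - exact/measurable_EFinP.
    - by move=> x _; rewrite lee_fin.
    - by rewrite lee_fin exprn_even_ge0.
  apply: ge0_le_integral => //.
  - by move=> x _; rewrite mule_ge0// lee_fin ?exprn_ge0// mdist_ge0.
  - apply: emeasurable_funM; last exact/measurable_EFinP.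
    by apply/measurable_EFinP; apply: measurable_funX; exact: measurable_mdist.
  - by apply: emeasurable_funM => //; exact/measurable_EFinP.
  - move=> x _; rewrite -!EFinM lee_fin /rho indicE.
    have [/set_mem|_] := boolP (x \in B); last by rewrite !mulr0.
    rewrite /B ballEmdist/= => xr; rewrite ler_wpM2r//; first by rewrite mulr1
      ltW.
    by rewrite lerXn2r ?nnegrE ?mdist_ge0 ?(ltW xr)// (le_trans _ (ltW xr))//
      mdist_ge0.
apply: (@le_lt_trans _ _
    (\int[m]_(x in [set x | (0 < rho x)%R]) (rho x * ln (rho x))%:E)).
  by apply: ereal_inf_lbound; exists rho.
have -> : [set x | (0 < rho x)%R] = B.
  apply/seteqP; split => x /=; rewrite /rho indicE.
    by have [/set_mem//|_] := boolP (x \in B); rewrite mulr0 ltxx.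
  by move=> Bx; rewrite mem_set// mulr1.
rewrite (eq_integral (fun=> (k * ln k)%:E)); last first.
  by move=> x xB; rewrite /rho indicE xB mulr1.
rewrite integral_cst//.
have /fineK <- : m B \is a fin_num by rewrite ge0_fin_numE// ltW.
by rewrite -EFinM ltry.
Qed.

End uniform_ball.

Section contraction.
Context {R : realType} {X : pmetricType R}.
Variable m : {measure set (borel X) -> \bar R}.
Implicit Types (mu nu : probability (borel X) R) (y : X).
Local Open Scope ereal_scope.

Lemma is_mms_gauss y : is_mms m ->
  exists2 C : R, (0 < C)%R &
    exists2 M : R, (0 < M)%R &
      \int[m]_z (expR (- C * mdist y z ^+ 2))%:E <= M%:E.
Proof.
move=> [_ _ _ _ [C [x [C0 fin]]]].
exists (2 * C)%R; first by rewrite mulr_gt0.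
have := gauss_integrable_moved y C0 fin.
set I := (X in X < _) => Iy.
have I0 : 0 <= I by apply: integral_ge0 => z _; rewrite lee_fin expR_ge0.
have Ifin : I \is a fin_num by rewrite ge0_fin_numE.
exists (fine I + 1)%R; first by rewrite ltr_wpDl// fine_ge0.
by rewrite EFinD fineK// leeDl.
Qed.

Lemma Ent_gtNy mu y (V : R) : is_mms m -> cost mu y <= V%:E -> -oo < Ent m mu.
Proof.
move=> hm hV; have [C C0 [M M0 hM]] := is_mms_gauss y hm.
by apply: lt_le_trans (Ent_ge_gauss C0 M0 hM hV); rewrite ltNyr.
Qed.

Lemma is_mms_small_ball y (e : R) : is_mms m -> (0 < e)%R ->
  exists2 r : R, (0 < r <= e)%R & 0 < m (ball y r) < +oo.
Proof.
move=> [_ _ fin supp _] e0; have [U [oU Uy mUy]] := fin y.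
have /nbhs_ballP[d /= d0 dU] : nbhs y U by exact: open_nbhs_nbhs.
exists (Num.min d e); first by rewrite lt_min d0 e0 ge_min lexx orbT.
have dd : (0 < Num.min d e)%R by rewrite lt_min d0.
apply/andP; split.
  have : msupport m y by rewrite supp.
  by apply; [exact: open_mball|exact: ballxx].
apply: le_lt_trans mUy; apply: le_measure; rewrite ?inE.
- exact: measurable_mball.
- exact: open_measurableX.
- apply: subset_trans dU; by apply: le_ball; rewrite ge_min lexx.
Qed.

(** The point at time t of a geodesic from a measure concentrated near y to nu
    lies at distance about t W2(delta_y, nu) from delta_y, and the squared
    distance to delta_y is the second moment about y.  In the concavity of U_N
    the contribution of the starting measure is nonnegative. *)
Lemma exists_contraction (N : R) nu y (V s2 t : R) :
  RCD0 N m -> P2 nu -> Ent m nu \is a fin_num ->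
  (0 <= V < s2)%R -> cost nu y <= V%:E -> (0 < t <= 1)%R ->
  exists mu, cost mu y <= (t ^+ 2 * s2)%:E /\
             t%:E * U_ N m nu <= U_ N m mu.
Proof.
move=> [hm _ geo] P2nu Enu /andP[V0 Vs2] hV /andP[t0 t1].
pose g := ((s2 - V) / 4)%R.
have g0 : (0 < g)%R by rewrite divr_gt0// subr_gt0.
pose l : R := Num.min 1%R (g / (V + 1))%R.
have V1 : (0 < V + 1)%R by rewrite ltr_wpDl.
have l0 : (0 < l)%R by rewrite lt_min ltr01 divr_gt0.
have l1 : (l <= 1)%R by rewrite ge_min lexx.
have lV : (l * V <= g)%R.
  have : (l * (V + 1) <= g)%R by rewrite -ler_pdivlMr// ge_min lexx orbT.
  by move: l0 V0; clear; nra.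
pose L := (1 + l^-1)%R.
have L0 : (0 < L)%R by rewrite addr_gt0// invr_gt0.
have t2 : (0 < t ^+ 2)%R by rewrite exprn_gt0.
have t21 : (t ^+ 2 <= 1)%R by rewrite exprn_ile1// ltW.
pose d := (t ^+ 2 * g / 8)%R.
have d0 : (0 < d)%R by rewrite divr_gt0// mulr_gt0.
(* [d] bounds each of the errors due to the radius of the starting ball and to
   an almost optimal coupling; in the end they total at
   most [5 * d <= t ^+ 2 * g]. *)
have [e e0 eL] : exists2 e : R, (0 < e)%R & (L * e ^+ 2 <= d)%R.
  exists (Num.sqrt (d / L)); first by rewrite sqrtr_gt0 divr_gt0.
  rewrite sqr_sqrtr; first by rewrite [leLHS]mulrC divfK ?gt_eqF.
  by apply: divr_ge0; exact: ltW.
have [r /andP[r0 re] mball] := is_mms_small_ball y hm e0.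
have [mu0 [cost0 Ent0]] := exists_concentrated nu mball.
have rL : (L * r ^+ 2 <= d)%R.
  apply: le_trans eL; apply: ler_wpM2l; first exact: ltW.
  by rewrite lerXn2r// nnegrE ltW.
have P2mu0 : P2 mu0 by exists y; apply: le_lt_trans cost0 _; rewrite ltry.
have Emu0 : Ent m mu0 \is a fin_num.
  by rewrite fin_numElt Ent0 andbT; exact: Ent_gtNy cost0.
have [mu [[mu_0 mu_1 P2mu W2mu] Umu]] := geo mu0 nu P2mu0 P2nu Emu0 Enu.
have t01 : (0 <= t <= 1)%R by rewrite ltW.
exists (mu t); split; last first.
  apply: le_trans (Umu t t01); rewrite leeDr// mule_ge0 ?expeR_ge0//.
  by rewrite lee_fin subr_ge0.
have cmu0 : cost (mu 0%R) y = cost mu0 y.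
  by apply: eq_measure_integral => A mA _; exact: mu_0.
have w1 : sqW2 mu0 nu <= ((1 + l) * V + L * r ^+ 2)%:E.
  apply: le_trans (sqW2_le mu0 nu y l0) _.
  rewrite [leRHS]EFinD [((1 + l) * V)%:E]EFinM [(L * _)%:E]EFinM.
  apply: leeD; apply: lee_wpmul2l => //.
    by rewrite lee_fin addr_ge0// ltW.
  by rewrite lee_fin ltW.
have w2 : sqW2 (mu 0%R) (mu t) <= (t ^+ 2 * ((1 + l) * V + L * r ^+ 2))%:E.
  rewrite -sqr_W2 W2mu// ?lexx ?ler01// subr0 ger0_norm ?(ltW t0)//.
  rewrite expe2 muleACA -EFinM -expr2 -[W2 _ _ * _]expe2 sqr_W2 [leRHS]EFinM.
  by apply: lee_wpmul2l; rewrite // lee_fin ltW.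
have : sqW2 (mu 0%R) (mu t) <
    (t ^+ 2 * ((1 + l) * V + L * r ^+ 2) + d)%:E.
  by apply: le_lt_trans w2 _; rewrite lte_fin ltrDl.
move=> /ereal_inf_lt[_ [p pc <-] /ltW hp].
apply: (le_trans (cost_le_coupling y l0 pc)).
apply: (@le_trans _ _ ((1 + l)%:E * (t ^+ 2 * ((1 + l) * V + L * r ^+ 2) + d)%:E
   + L%:E * (r ^+ 2)%:E)).
  apply: leeD; apply: lee_wpmul2l => //.
  - by rewrite lee_fin addr_ge0// ltW.
  - by rewrite lee_fin ltW.
  - by rewrite cmu0.
rewrite -!EFinM -EFinD lee_fin.
have hl : ((1 + l) ^+ 2 * V <= V + 3 * g)%R.
  have : (l * (l * V) <= l * V)%R by rewrite ler_piMl// mulr_ge0// ltW.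
  by lra.
have hd : (8 * d = t ^+ 2 * g)%R by rewrite /d; field.
have hs : (s2 = V + 4 * g)%R by rewrite /g; field.
have : (t ^+ 2 * ((1 + l) ^+ 2 * V) <= t ^+ 2 * (V + 3 * g))%R.
  by rewrite ler_wpM2l// ltW.
have Lr0 : (0 <= L * r ^+ 2)%R by apply: mulr_ge0; [exact: ltW|exact: sqr_ge0].
have : ((1 + l) * t ^+ 2 * (L * r ^+ 2) <= 2 * d)%R.
  apply: (@le_trans _ _ (2 * (L * r ^+ 2))%R); last by rewrite ler_pM2l.
  rewrite ler_wpM2r//; apply: (@le_trans _ _ (2 * t ^+ 2)%R); last by lra.
  by rewrite ler_wpM2r ?(ltW t2)//; lra.
have : ((1 + l) * d <= 2 * d)%R by rewrite ler_wpM2r ?(ltW d0)//; lra.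
rewrite hs; move: rL hd d0; clear.
lra.
Qed.

End contraction.

(** * The entropy bound *)

Section entropy_upper_bound.
Context {R : realType} {X : pmetricType R}.
Variable m : {measure set (borel X) -> \bar R}.
Implicit Types (mu nu : probability (borel X) R) (y : X).

Lemma cost_le_moved nu (x y : X) (l : R) : 0 < l ->
  (cost nu y <= (1 + l)%:E * cost nu x + ((1 + l^-1) * mdist x y ^+ 2)%:E)%E.
Proof.
move=> l0; have l1 : 0 <= 1 + l by rewrite addr_ge0// ltW.
have il1 : 0 <= 1 + l^-1 by rewrite addr_ge0// invr_ge0 ltW.
have md (z : X) : measurable_fun [set: borel X]
    (fun w : borel X => (mdist z w ^+ 2)%:E).
  by apply/measurable_EFinP; apply: measurable_funX; exact: measurable_mdist.
have sq0 (u v : X) : (0 <= (mdist u v ^+ 2)%:E :> \bar R)%E.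
  by rewrite lee_fin exprn_ge0// mdist_ge0.
rewrite /cost -ge0_integralZl//.
have -> : ((1 + l^-1) * mdist x y ^+ 2)%:E =
    (\int[nu]_z ((1 + l^-1) * mdist x y ^+ 2)%:E)%E.
  by rewrite integral_cst// [X in (_ * X)%E]probability_setT mule1.
rewrite -ge0_integralD//; last 3 first.
- by move=> z _; exact: mule_ge0.
- exact: emeasurable_funM.
- by move=> z _; rewrite lee_fin mulr_ge0// exprn_ge0// mdist_ge0.
apply: ge0_le_integral => //.
- by apply: emeasurable_funD => //; exact: emeasurable_funM.
- by move=> z _; rewrite -EFinM -EFinD lee_fin; exact: young_mdist.
Qed.

(** exp (- b k^2) <= exp (- b k), and exp (b k) exceeds the term of degree N + 1
    of its power series. *)
Lemma power_mul_expN_le (N k : nat) (b : R) : (0 < k)%N -> 0 < b ->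
  k%:R ^+ N * expR (- (b * k%:R ^+ 2)) <= (N.+1)`!%:R / b ^+ N.+1 / k%:R.
Proof.
move=> k0 b0; have k1 : 1 <= k%:R :> R by rewrite ler1n.
have kR : 0 < k%:R :> R by rewrite ltr0n.
have bk0 : 0 < b * k%:R by rewrite mulr_gt0.
have f0 : 0 < (N.+1)`!%:R :> R by rewrite ltr0n fact_gt0.
apply: (@le_trans _ _ (k%:R ^+ N * expR (- (b * k%:R)))).
  rewrite ler_wpM2l ?exprn_ge0//; rewrite ler_expR lerN2 ler_wpM2l ?(ltW b0)//.
  by rewrite expr2 ler_peMr// ltW.
rewrite expRN ler_pdivrMr ?expR_gt0//.
have h := expR_ge1Dxn N (ltW bk0).
have {}h : (b * k%:R) ^+ N.+1 / (N.+1)`!%:R <= expR (b * k%:R) by lra.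
apply: (@le_trans _ _ ((N.+1)`!%:R / b ^+ N.+1 / k%:R *
    ((b * k%:R) ^+ N.+1 / (N.+1)`!%:R))).
  rewrite le_eqVlt; apply/orP; left; apply/eqP.
  rewrite exprMn [k%:R ^+ N.+1]exprS; field.
  by rewrite !gt_eqF// exprn_gt0.
by apply: ler_wpM2l => //; rewrite !divr_ge0 ?exprn_ge0// ltW.
Qed.

(** The contracted measures of [exists_contraction] at the times t = 1 / k are
    compared with Gaussians of matching width: for c = N / (2 t^2 s2) the
    second-moment term of [Ent_ge_gauss] is N / 2.  The powers of t on both
    sides cancel, and the remainder of the Gaussian integral is O(1 / k) by
    [power_mul_expN_le]. *)
Lemma expRN_Ent_le_of_growth (N : nat) nu y (a r0 E V s2 : R) :
  (0 < N)%N -> RCD0 N%:R m -> P2 nu -> Ent m nu = E%:E ->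
  0 < a -> 0 < r0 ->
  (forall r, 0 < r < r0 -> (m (clball y r) <= (a * omega N * r ^+ N)%:E)%E) ->
  0 <= V < s2 -> (cost nu y <= V%:E)%E ->
  expR (- E) <= a * (2 * pi * expR 1 / N%:R * s2) `^ (N%:R / 2).
Proof.
move=> N0 rcd P2nu EntE a0 r00 growth Vs hV.
have NR : 0 < N%:R :> R by rewrite ltr0n.
have s20 : 0 < s2 by move/andP: Vs => [V0]; exact: le_lt_trans.
have hm : is_mms m by case: rcd.
have [C C0 [M M0 hM]] := is_mms_gauss y hm.
pose r1 := r0 / 2.
have r1r0 : 0 < r1 < r0 by rewrite /r1; apply/andP; split; lra.
have [r10 _] := andP r1r0.
pose b : R := N%:R / (2 * s2) * r1 ^+ 2.
have Ns0 : 0 < N%:R / (2 * s2) by rewrite divr_gt0// mulr_gt0.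
have b0 : 0 < b by rewrite mulr_gt0// exprn_gt0.
pose D : R := M * expR (C * r1 ^+ 2) * ((N.+1)`!%:R / b ^+ N.+1) * expR (N%:R /
  2).
have D0 : 0 <= D by rewrite !mulr_ge0 ?expR_ge0 ?invr_ge0 ?exprn_ge0 ?(ltW b0)
  ?(ltW M0).
suff main (k : nat) : (0 < k)%N -> C < N%:R / (2 * s2) * k%:R ->
    expR (- E) <= a * (2 * pi * expR 1 / N%:R * s2) `^ (N%:R / 2) + D / k%:R.
  apply/ler_addgt0Pr => e e0.
  pose k := (Num.truncn (C / (N%:R / (2 * s2)) + D / e)).+1.
  have hk : C / (N%:R / (2 * s2)) + D / e < k%:R.
    exact: truncnS_gt.
  have C1 : 0 < C / (N%:R / (2 * s2)) by rewrite divr_gt0.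
  have D1 : 0 <= D / e by rewrite divr_ge0// ltW.
  have kR : 0 < k%:R :> R by rewrite ltr0n.
  apply: le_trans (main k _ _) _ => //.
    by rewrite mulrC -ltr_pdivrMr//; lra.
  rewrite lerD2l ler_pdivrMr// mulrC -ler_pdivrMr//; lra.
move=> k0 Ck; have kR : 0 < k%:R :> R by rewrite ltr0n.
have k1 : 1 <= k%:R :> R by rewrite ler1n.
pose t : R := k%:R^-1.
have t01 : 0 < t <= 1 by rewrite invr_gt0 kR invf_le1.
have [mu [costmu Umu]] : exists mu, (cost mu y <= (t ^+ 2 * s2)%:E)%E /\
    (t%:E * U_ N%:R m nu <= U_ N%:R m mu)%E.
  by apply: exists_contraction hV t01 => //; rewrite EntE.
pose c : R := N%:R / (2 * s2) * k%:R ^+ 2.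
have Cc : 0 < C < c.
  rewrite C0 (lt_le_trans Ck)// ler_wpM2l ?(ltW Ns0)//.
  by rewrite expr2 ler_peMr// ltW.
have c0 : 0 < c by have [_] := andP Cc; exact: lt_trans.
have hZ := gauss_integral_le N0 (ltW a0) r1r0 Cc growth hM.
set Z := (X in (_ <= X%:E)%E) in hZ.
have Z0 : 0 < Z.
  by rewrite ltr_pwDl// ?mulr_gt0 ?powR_gt0 ?divr_gt0 ?pi_gt0// mulr_ge0
    ?expR_ge0// ltW.
have := Ent_ge_gauss c0 Z0 hZ costmu.
have -> : c * (t ^+ 2 * s2) = N%:R / 2.
  by rewrite /c /t; field; rewrite !gt_eqF.
move=> Emu.
have {Emu Umu} : t * expR (- (E / N%:R)) <= expR ((ln Z + N%:R / 2) / N%:R).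
  rewrite -lee_fin EFinM.
  have -> : (expR (- (E / N%:R)))%:E = U_ N%:R m nu.
    by rewrite /U_ EntE -EFinM /= mulrC.
  apply: (le_trans Umu).
  have -> : (expR ((ln Z + N%:R / 2) / N%:R))%:E =
      expeR ((ln Z + N%:R / 2) / N%:R)%:E by [].
  rewrite /U_ lee_expeR leeNl -EFinN -mulNr EFinM muleC.
  by apply: lee_wpmul2l => //; rewrite lee_fin invr_ge0 ltW.
move=> Umu.
have {}Umu : t ^+ N * expR (- E) <= Z * expR (N%:R / 2).
  have -> : expR (- E) = expR (- (E / N%:R)) ^+ N.
    by rewrite -expRM_natl; congr expR; field; rewrite gt_eqF.
  have -> : Z * expR (N%:R / 2) = expR ((ln Z + N%:R / 2) / N%:R) ^+ N.
    rewrite -expRM_natl -{1}[Z]lnK// -expRD; congr expR.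
    by field; rewrite gt_eqF.
  have tE0 : 0 <= t * expR (- (E / N%:R)).
    by rewrite mulr_ge0 ?expR_ge0// /t invr_ge0 ltW.
  by rewrite -exprMn; apply: lerXn2r; rewrite // nnegrE// expR_ge0.
have kN0 : 0 < k%:R ^+ N :> R by rewrite exprn_gt0.
have {Umu} h : expR (- E) <= k%:R ^+ N * (Z * expR (N%:R / 2)).
  by rewrite -ler_pdivrMl// -exprVn.
apply: (le_trans h); rewrite /Z mulrDl mulrDr; apply: lerD.
  have pe : 0 <= pi :> R by exact: pi_ge0.
  have kk : k%:R ^+ N = (k%:R ^+ 2) `^ (N%:R / 2) :> R.
    rewrite -[k%:R ^+ 2]powR_mulrn ?(ltW kR)// -powRrM mulrC divfK//.
    by rewrite powR_mulrn// ltW.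
  rewrite kk (_ : expR (N%:R / 2) = expR 1 `^ (N%:R / 2)); last first.
    by rewrite -expRM mul1r.
  rewrite -mulrA mulrCA -!powRM ?expR_ge0 ?exprn_ge0 ?mulr_ge0 ?invr_ge0 ?(ltW
    c0) ?(ltW kR) ?expR_ge0//.
  rewrite le_eqVlt; apply/orP; left; apply/eqP; congr (_ * _ `^ _).
  by rewrite /c; field; rewrite !gt_eqF.
have -> : - (c - C) * r1 ^+ 2 = C * r1 ^+ 2 - b * k%:R ^+ 2.
  by rewrite /c /b; ring.
rewrite expRD (_ : k%:R ^+ N * _ = M * expR (C * r1 ^+ 2) *
  (k%:R ^+ N * expR (- (b * k%:R ^+ 2))) * expR (N%:R / 2)); last by ring.
have -> : D / k%:R = M * expR (C * r1 ^+ 2) *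
    ((N.+1)`!%:R / b ^+ N.+1 / k%:R) * expR (N%:R / 2) by rewrite /D; ring.
rewrite ler_wpM2r ?expR_ge0// ler_wpM2l ?mulr_ge0 ?expR_ge0 ?(ltW M0)//.
exact: power_mul_expN_le.
Qed.

End entropy_upper_bound.

Theorem theorem1p2 (R : realType) (X : pmetricType R) (N : nat)
  (m : {measure set (borel X) -> \bar R}) (nu : probability (borel X) R)
  (hN : (2 <= N)%N)
  (hX : noncollapsed_RCD0 N m)
  (hnu : P2 nu)
  (hb : barycenters nu `&` regular_set m N !=set0) :
  (- Ent m nu <=
   (N%:R / 2)%:E * lne ((2 * pi * expR 1 / N%:R)%:E * Var nu))%E.
Proof.
have [rcd mE] := hX; have hm : is_mms m by case: rcd.
have N0 : (0 < N)%N by exact: leq_trans hN.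
have NR : 0 < N%:R :> R by rewrite ltr0n.
have [x [xb _]] := hb; rewrite -xb.
have costx : cost nu x \is a fin_num.
  rewrite ge0_fin_numE ?cost_ge0//; have [x0 hx0] := hnu.
  apply: le_lt_trans (cost_le_moved nu x0 x ltr01) _.
  by rewrite lte_add_pinfty ?ltry// lte_mul_pinfty ?lee_fin ?ler0n.
set V := fine (cost nu x); have VE : cost nu x = V%:E by rewrite fineK.
have V0 : 0 <= V by rewrite fine_ge0 ?cost_ge0.
have EntNy : (-oo < Ent m nu)%E by apply: (@Ent_gtNy _ _ _ _ x V) => //;
  rewrite VE.
case EntE : (Ent m nu) => [E||]; [|by rewrite leNye|by rewrite EntE in EntNy].
pose k : R := 2 * pi * expR 1 / N%:R.
have k0 : 0 < k by rewrite /k !mulr_gt0 ?pi_gt0 ?expR_gt0 ?invr_gt0.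
have bound s : V < s -> - E <= N%:R / 2 * ln (k * s).
  move=> Vs; have s0 : 0 < s by exact: le_lt_trans Vs.
  pose g := (s - V) / 4; have g0 : 0 < g by rewrite divr_gt0// subr_gt0.
  pose l := g / (V + 1); have V1 : 0 < V + 1 by rewrite ltr_wpDl.
  have l0 : 0 < l by rewrite divr_gt0.
  have lV : l * V <= g.
    by rewrite /l mulrAC ler_pdivrMr// ler_wpM2l ?(ltW g0)//; lra.
  have il0 : 0 < 1 + l^-1 by rewrite addr_gt0// invr_gt0.
  pose d := Num.sqrt (g / (1 + l^-1)).
  have d0 : 0 < d by rewrite sqrtr_gt0 divr_gt0.
  have near y : ball x d y -> (cost nu y <= (V + 2 * g)%:E)%E.
    rewrite ballEmdist/= => xy; apply: (le_trans (cost_le_moved nu x y l0)).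
    rewrite VE -EFinM -EFinD lee_fin mulrDl mul1r -addrA lerD2l mulr_natl
      mulr2n.
    apply: lerD => //; rewrite -ler_pdivlMl// mulrC.
    rewrite -[leRHS]sqr_sqrtr; last by apply: divr_ge0; exact: ltW.
    by rewrite lerXn2r ?nnegrE ?mdist_ge0 ?(ltW d0)// ltW.
  have Vs2 : 0 <= V + 2 * g < s.
    apply/andP; split; first by rewrite addr_ge0// mulr_ge0// ltW.
    by rewrite /g; lra.
  have [r /andP[r0 rd] mball] := is_mms_small_ball x hm d0.
  apply/ler_addgt0Pr => e e0; have e1 : 1 < expR e by rewrite expR_gt1.
  have [y [/(le_ball rd) /near costy [r1 r10 growth]]] :=
    exists_small_density N0 mE e1 (open_mball x r) mball.
  have := expRN_Ent_le_of_growth N0 rcd hnu EntE (expR_gt0 e) r10 growth Vs2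
    costy.
  have ks0 : 0 < (k * s) `^ (N%:R / 2) by apply: powR_gt0; exact: mulr_gt0.
  have eks0 := mulr_gt0 (expR_gt0 e) ks0.
  rewrite -/k -ler_ln ?posrE ?expR_gt0// lnM ?posrE ?expR_gt0// ln_powR !expRK.
  by rewrite addrC.
rewrite VE -EFinM -/k.
have [Vpos|] := ltP 0 V.
  have kV0 : 0 < k * V by exact: mulr_gt0.
  rewrite lne_EFin// -EFinN -EFinM lee_fin.
  apply/ler_addgt0Pr => e e0.
  have := bound (V * expR (2 / N%:R * e)).
  have Ne0 : 0 < 2 / N%:R * e by rewrite mulr_gt0// divr_gt0.
  rewrite ltr_pMr// expR_gt1 Ne0 => /(_ isT).
  rewrite mulrA lnM ?posrE ?expR_gt0// expRK mulrDr [_ * (2 / _ * _)]mulrA.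
  by rewrite (_ : N%:R / 2 * (2 / N%:R) = 1) ?mul1r//; field; rewrite gt_eqF.
(* A vanishing variance is incompatible with finite entropy: [bound] would give
   [- E <= - E - 1]. *)
move=> V_le0; have V00 : V = 0 by apply/eqP; rewrite eq_le V_le0.
have := bound (expR ((- E - 1) * (2 / N%:R)) / k).
rewrite V00 divr_gt0 ?expR_gt0// => /(_ isT).
rewrite [k * _]mulrC divfK ?gt_eqF// expRK mulrCA.
have -> : N%:R / 2 * (2 / N%:R) = 1 :> R by field; rewrite gt_eqF.
by rewrite mulr1 => h; exfalso; lra.
Qed.
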